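(* Let $s\in(0,1/2)$ and let $n$ be the dimension of the ambient space $\mathbb{R}^n$. For $\delta>0$ let $$K_\delta:=\big(B_{1+\delta}\setminus B_1\big)\cap\{x_n<0\},$$ and let $E_\delta$ be the set minimizing $\mathrm{Per}_s(E,B_1)$ among all the sets $E\subseteq\mathbb{R}^n$ such that $E\setminus B_1=K_\delta$. Then there exists $\delta_o>0$, depending on $s$ and $n$, such that for any $\delta\in(0,\delta_o]$ we have $$E_\delta=K_\delta.$$
   Context: $B_r$ is the ball of radius $r$ centered at the origin of $\mathbb{R}^n$. For $s\in(0,1/2)$, an open set $\Omega\subseteq\mathbb{R}^n$ and $E\subseteq\mathbb{R}^n$, with $E^c:=\mathbb{R}^n\setminus E$, the $s$-perimeter of $E$ in $\Omega$ is $$\mathrm{Per}_s(E,\Omega):=L(E\cap\Omega,E^c)+L(\Omega\setminus E,E\setminus\Omega),\qquad L(F,G):=\iint_{F\times G}\frac{dx\,dy}{|x-y|^{n+2s}}$$ for disjoint sets $F,G$. Sets are measurable and, as usual for minimizers, are understood up to sets of Lebesgue measure zero. *)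

(* Defs.v *)
From HB Require Import structures.
From mathcomp Require Import all_boot all_order all_algebra.
From mathcomp Require Import all_classical all_reals all_analysis.

Set Implicit Arguments.
Unset Strict Implicit.
Unset Printing Implicit Defensive.

Import Order.TTheory GRing.Theory Num.Theory.
Import numFieldNormedType.Exports.

Local Open Scope classical_set_scope.
Local Open Scope ring_scope.

(* R^n as a measurable space: tuples carry the product sigma-algebra of the
   Borel sets of R, i.e. the Borel sets of R^n. *)
Notation euclidean R n := (n.-tuple (measurableTypeR R)) (only parsing).

Section lebesgue_measure_euclidean.
Context {R : realType}.
Local Open Scope ereal_scope.

Definition euclidean_cons (n : nat) (p : measurableTypeR R * euclidean R n) :
  euclidean R n.+1 := [tuple of p.1 :: p.2].

Lemma measurable_euclidean_cons (n : nat) :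
  measurable_fun [set: measurableTypeR R * euclidean R n]
    (@euclidean_cons n).
Proof. exact: measurable_cons. Qed.

Section step.
Variables (n : nat) (mu : {sigma_finite_measure set (euclidean R n) -> \bar R}).

Definition lebesgue_step : set (euclidean R n.+1) -> \bar R :=
  pushforward (lebesgue_measure \x mu) (@euclidean_cons n).

Let lebesgue_step0 : lebesgue_step set0 = 0.
Proof. by rewrite /lebesgue_step /pushforward preimage_set0 measure0. Qed.

Let lebesgue_step_ge0 A : 0 <= lebesgue_step A.
Proof. by rewrite /lebesgue_step /pushforward measure_ge0. Qed.

Let lebesgue_step_sigma_additive : semi_sigma_additive lebesgue_step.
Proof.
move=> F mF tF mUF; rewrite /lebesgue_step /pushforward preimage_bigcup.
have mc A : measurable A -> measurable (@euclidean_cons n @^-1` A).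
  by move=> mA; rewrite -[X in measurable X]setTI; exact: measurable_euclidean_cons.
apply: measure_semi_sigma_additive.
- by move=> k; exact: mc.
- apply/trivIsetP => /= i j _ _ ij; rewrite -preimage_setI.
  by move/trivIsetP : tF => /(_ _ _ _ _ ij) ->//; rewrite preimage_set0.
- by rewrite -preimage_bigcup; exact: mc.
Qed.

HB.instance Definition _ := isMeasure.Build _ _ _ lebesgue_step
  lebesgue_step0 lebesgue_step_ge0 lebesgue_step_sigma_additive.

Let lebesgue_step_sigma_finite : sigma_finite setT lebesgue_step.
Proof.
have /sigma_finiteP[F [UF ndF Ffin]] := sigma_finiteT (@lebesgue_measure R).
have /sigma_finiteP[G [UG ndG Gfin]] := sigma_finiteT mu.
pose g (t : euclidean R n.+1) : measurableTypeR R * euclidean R n :=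
  (thead t, [tuple of behead t]).
have cK : cancel (@euclidean_cons n) g.
  by move=> [x t]; congr pair; apply: val_inj.
have mg : measurable_fun setT g.
  apply: measurable_fun_pair; first exact: measurable_tnth.
  exact: measurable_behead.
exists (fun k => g @^-1` (F k `*` G k)) => [|k].
  rewrite -preimage_bigcup; apply/esym/seteqP; split=> // t _ /=.
  have [i _ Fi] : (\bigcup_k F k) (g t).1 by rewrite -UF.
  have [j _ Gj] : (\bigcup_k G k) (g t).2 by rewrite -UG.
  exists (maxn i j) => //; split.
    by move: Fi; exact/subsetPset/ndF/leq_maxl.
  by move: Gj; exact/subsetPset/ndG/leq_maxr.
have [mF Foo] := Ffin k; have [mG Goo] := Gfin k; split.
  rewrite -[X in measurable X]setTI; apply: mg => //; exact: measurableX.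
rewrite /lebesgue_step /pushforward -comp_preimage (_ : g \o _ = id).
  by rewrite preimage_id product_measure1E// lte_mul_pinfty// ge0_fin_numE.
by apply/funext => p /=; rewrite cK.
Qed.

HB.instance Definition _ := Measure_isSigmaFinite.Build _ _ _ lebesgue_step
  lebesgue_step_sigma_finite.

End step.

Fixpoint lebesgue (n : nat) :
    {sigma_finite_measure set (euclidean R n) -> \bar R} :=
  match n return {sigma_finite_measure set (euclidean R n) -> \bar R} with
  | 0 => dirac ([tuple] : euclidean R 0)
  | m.+1 => lebesgue_step (lebesgue m)
  end.

End lebesgue_measure_euclidean.

Section fractional_perimeter.
Context {R : realType} {n : nat}.
Implicit Types (x y : euclidean R n) (E F G K Omega : set (euclidean R n)).

Definition euclidean_dist x y : R :=
  Num.sqrt (\sum_(i < n) ((tnth x i : R) - (tnth y i : R)) ^+ 2).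

Definition euclidean_ball (r : R) : set (euclidean R n) :=
  [set x | euclidean_dist x [tuple 0 | i < n] < r].

(* The integrand takes the value 0, rather than +oo, on the diagonal; the
   diagonal does not meet F `*` G for the disjoint F and G of interest. *)
Definition interaction (s : R) F G : \bar R :=
  (\int[lebesgue n \x lebesgue n]_(z in F `*` G)
     ((euclidean_dist z.1 z.2 `^ (n%:R + 2 * s))^-1)%:E)%E.

Definition Per (s : R) E Omega : \bar R :=
  (interaction s (E `&` Omega) (~` E)
   + interaction s (Omega `\` E) (E `\` Omega))%E.

Definition eq_ae E F := lebesgue n (E `+` F) = 0%E.

(* Every Lebesgue measurable set is almost everywhere equal to a Borel set, so
   admissible sets are taken in the Borel sigma-algebra. *)
Definition admissible Omega K E := measurable E /\ eq_ae (E `\` Omega) K.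

Definition minimizer (s : R) Omega K E :=
  admissible Omega K E /\
  forall F, admissible Omega K F -> (Per s E Omega <= Per s F Omega)%E.

End fractional_perimeter.

Definition half_shell {R : realType} {n : nat} (delta : R) :
    set (euclidean R n.+1) :=
  (euclidean_ball (1 + delta) `\` euclidean_ball 1) `&` [set x | (tnth x ord_max : R) < 0].

(* Main.v *)
Require Import Defs.
From mathcomp Require Import all_boot all_order all_algebra.
From mathcomp Require Import all_classical all_reals all_analysis.
From mathcomp Require Import measurable_realfun.
From mathcomp Require Import ring lra.

Set Implicit Arguments.
Unset Strict Implicit.
Unset Printing Implicit Defensive.

Import Order.TTheory GRing.Theory Num.Theory.
Import numFieldNormedType.Exports.

Local Open Scope classical_set_scope.
Local Open Scope ring_scope.

(** Let B be the unit ball of R^N, K the half shell, k(x,y) = |x-y|^-(N+2s) and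
    L the interaction with kernel k. Up to null sets a competitor is the union
    of K and of a set A inside B, and, L(B,K) being finite,
<<
      Per(A u K) - Per(K) = L(A, B \ A) + L(A, (B u K)^c) - L(A, K).
>>
    It suffices to bound this from below by a positive multiple of |A|. This
    gives at once that K is a minimizer and that it is the only one.

    The term L(A, (B u K)^c) is at least c0 |A|, because every point of B sees
    a fixed cube far away (far_interaction). The difficulty is the singular part
    of L(A, K): when A hugs K it does not get small with the width of the shell,
    and it is compensated by L(A, B \ A) only. The compensation is obtained from
    a calibration by concentric spheres. Consider the flow p(x,y) which, for
    |y| < |x| and |x-y| < rho, carries the mass k(x,y) from x to y, multiplied by
    cut-offs vanishing on the ball of radius 1/2 (radial_flow). Two facts are
    needed.

    - At every point x the incoming mass exceeds the outgoing mass by at most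
      C rho^(1-2s) (radial_flow_balance). Indeed, of the two points x + h and
      x - h at least one lies outside the sphere through x. If exactly one does,
      then incoming and outgoing mass cancel up to the variation of the cut-off,
      which is O(|h|). If both do, then |x.h| <= |h|^2/2, and such h form a thin
      neighbourhood of the tangent hyperplane, of measure O(r^(N+1)) in a ball
      of radius r (lebesgue_slab_le). Both errors are integrable against
      |h|^-(N+2s) exactly because 2s < 1 (integral_shell_le).

    - From a point y outside B to a point x of B at distance less than rho, the
      flow is the full kernel k(x,y), since the cut-offs are equal to 1 there.
      Hence the incoming mass at x contains all of the singular part of the
      interaction of x with K.

    Integrating over A, the flow between points of A cancels, the flow from A to
    B \ A is at most L(A, B \ A), and what remains is
<<
      L(A, K) <= L(A, B \ A) + (C rho^(1-2s) + rho^-(N+2s) |K|) |A|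
>>
    (calibration). It remains to choose rho small, and then the shell thin, so
    that the constant in front of |A| is at most c0 / 2. For A = B the same inequality shows
    that L(B, K) is finite.

    To give a meaning to the cancellation, the kernel is truncated at |x-y| >= eps;
    all the bounds are uniform in eps, which then tends to 0. *)

(** * Invariance of the Lebesgue measure under point reflections *)

Section mirror.
Context {R : realType}.

(** Point reflections are the only isometries used below: a translation is the
    composition of two of them. *)
Definition mirror {n} (c y : euclidean R n) : euclidean R n :=
  [tuple (tnth c i : R) - (tnth y i : R) | i < n].

Lemma tnth_mirror n (c y : euclidean R n) i :
  tnth (mirror c y) i = (tnth c i : R) - (tnth y i : R).
Proof. by rewrite tnth_mktuple. Qed.

Lemma measurable_tnthR d (T : measurableType d) n (i : 'I_n)
    (f : T -> euclidean R n) : measurable_fun setT f ->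
  measurable_fun setT (fun x => tnth (f x) i : R).
Proof.
move=> mf; apply: (@measurableT_comp _ _ _ _ _ _
  (fun x : euclidean R n => tnth x i)) => //; exact: measurable_tnth.
Qed.

Lemma measurable_mirror n (c : euclidean R n) : measurable_fun setT (mirror c).
Proof.
apply/measurable_fun_tnthP => i /=.
rewrite (_ : _ \o _ = fun y => (tnth c i : R) - (tnth y i : R)); last first.
  by apply/funext => y /=; rewrite tnth_mirror.
by apply: measurable_funB => //; exact: measurable_tnthR.
Qed.

Lemma measurable_mirror_preimage n (c : euclidean R n) A :
  measurable A -> measurable (mirror c @^-1` A).
Proof. by move=> mA; rewrite -[X in measurable X]setTI; exact: measurable_mirror. Qed.

Let refl1 (c : R) : measurableTypeR R -> measurableTypeR R := fun t => c - (t : R).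

Let measurable_refl1 c : measurable_fun setT (refl1 c).
Proof. exact: measurable_funB. Qed.

Let lebesgue_measure_refl1 (c : R) (A : set R) : measurable A ->
  pushforward lebesgue_measure (refl1 c) A = lebesgue_measure A.
Proof.
move=> mA; apply/esym/lebesgue_measure_unique => //= _ [[a b]] _ <-.
rewrite /pushforward/= (_ : _ @^-1` _ = `[c - b, c - a[%classic); last first.
  by apply/seteqP; split=> x /=; rewrite /refl1 !in_itv/=; lra.
rewrite !lebesgue_measure_itv/= !lte_fin.
rewrite (_ : (c - b < c - a) = (a < b)); last by apply/idP/idP; lra.
by case: ifP => //; rewrite -!EFinB => _; congr EFin; lra.
Qed.

(** By slicing along the first coordinate, this reduces to the invariance of the
    one-dimensional measure, which is decided on intervals. *)
Lemma lebesgue_mirror n (c : euclidean R n) A : measurable A ->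
  lebesgue n (mirror c @^-1` A) = lebesgue n A.
Proof.
elim: n => [|n IH] in c A *.
  move=> mA; rewrite [in RHS](_ : A = mirror c @^-1` A)//.
  by apply/seteqP; split => x /=; rewrite [mirror c x]tuple0 [x]tuple0.
move=> mA /=; rewrite /lebesgue_step /pushforward /=.
have mB : measurable (@euclidean_cons R n @^-1` A).
  by rewrite -[X in measurable X]setTI; exact: measurable_euclidean_cons.
set B := _ @^-1` A in mB *.
pose c' : euclidean R n := [tuple of behead c].
have mirror_cons x t : mirror c (euclidean_cons (x, t)) =
    euclidean_cons (refl1 (thead c) x, mirror c' t).
  apply: eq_from_tnth => i; rewrite tnth_mirror.
  case: (unliftP ord0 i) => [j ->|->]; rewrite ?tnthS ?tnth0//.
  by rewrite tnth_mirror [c in LHS]tuple_eta tnthS.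
rewrite /product_measure1.
transitivity (\int[lebesgue_measure]_x
    lebesgue n (xsection B (refl1 (thead c) x)))%E.
  apply: eq_integral => x _ /=.
  rewrite -[RHS](IH c'); last exact: measurable_xsection.
  congr (lebesgue n _); apply/seteqP; split => t;
    by rewrite /xsection/= !inE /B/= mirror_cons.
rewrite -(@ge0_integral_pushforward _ _ _ _ _ _ (measurable_refl1 (thead c))
  lebesgue_measure setT (fun x => lebesgue n (xsection B x)))//.
- by apply: eq_measure_integral => D mD _ /=; exact: lebesgue_measure_refl1.
- exact: measurable_fun_xsection.
Qed.

Lemma integral_mirror n (c : euclidean R n) (f : euclidean R n -> \bar R) :
  measurable_fun setT f -> (forall y, 0 <= f y)%E ->
  (\int[lebesgue n]_y f (mirror c y) = \int[lebesgue n]_y f y)%E.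
Proof.
move=> mf f0.
rewrite -[LHS](@ge0_integral_pushforward _ _ _ _ _ _ (measurable_mirror c)
  (lebesgue n) setT f)//.
apply: eq_measure_integral => [|mr A mA _]; first exact: measurable_mirror.
exact: (lebesgue_mirror c mA).
Qed.

End mirror.

(** * Cubes *)

Section box.
Context {R : realType}.

Definition box {n} (c : euclidean R n) (r : R) : set (euclidean R n) :=
  [set x | forall i, `|(tnth x i : R) - tnth c i| <= r].

Lemma measurable_box n (c : euclidean R n) r : measurable (box c r).
Proof.
rewrite (_ : box c r = \bigcap_(i in [set: 'I_n])
   ((fun x => `|(tnth x i : R) - tnth c i|) @^-1` `]-oo, r])); last first.
  by apply/seteqP; split=> x /= h => [i _|i]; have := h i; rewrite /= in_itv/= => ->.
apply: fin_bigcap_measurable => // i _.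
rewrite -[X in measurable X]setTI.
apply: (@measurableT_comp _ _ _ _ _ _ (fun x : R => `|x|)) => //.
by apply: measurable_funB => //; exact: measurable_tnthR.
Qed.

Lemma lebesgue_box n (c : euclidean R n) r : 0 <= r ->
  lebesgue n (box c r) = ((2 * r) ^+ n)%:E.
Proof.
move=> r0; elim: n => [|n IH] in c *.
  by rewrite expr0 /= diracE mem_set// => -[].
pose c' : euclidean R n := [tuple of behead c].
rewrite /= /lebesgue_step /pushforward /=.
rewrite (_ : _ @^-1` _ = `[thead c - r, thead c + r]%classic `*` box c' r); last first.
  have tc (i : 'I_n) : tnth c (lift ord0 i) = tnth c' i.
    by rewrite [c in LHS]tuple_eta tnthS.
  apply/seteqP; split => -[x t]; rewrite /box/=.
    move=> h; split.
      by have := h ord0; rewrite tnth0 in_itv/= ler_distl.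
    by move=> i; have := h (lift ord0 i); rewrite tnthS tc.
  move=> [h1 h2] i; case: (unliftP ord0 i) => [j ->|->].
    by rewrite tnthS tc.
  by move: h1; rewrite tnth0 ler_distl in_itv.
rewrite product_measure1E//; last exact: measurable_box.
rewrite [X in (_ * X)%E]IH /= lebesgue_measure_itv/= lte_fin exprS EFinM.
case: ifPn => [_|h]; first by congr (_ * _)%E; rewrite -EFinB; congr EFin; lra.
have -> : r = 0 by lra.
by rewrite mulr0 !mul0e.
Qed.

End box.

(** * Distances, balls and thin slabs *)

Section distance.
Context {R : realType} {n : nat}.
Implicit Types x y z c : euclidean R n.

Definition origin : euclidean R n := [tuple 0 | i < n].

Local Notation norm x := (euclidean_dist x origin).

Lemma dist_ge0 x y : 0 <= euclidean_dist x y.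
Proof. exact: sqrtr_ge0. Qed.

Lemma dist_sqr x y :
  euclidean_dist x y ^+ 2 = \sum_(i < n) ((tnth x i : R) - tnth y i) ^+ 2.
Proof. by rewrite sqr_sqrtr// sumr_ge0// => i _; exact: sqr_ge0. Qed.

Lemma dist_sym x y : euclidean_dist x y = euclidean_dist y x.
Proof.
by congr Num.sqrt; apply: eq_bigr => i _; rewrite -sqrrN opprB.
Qed.

Lemma norm_sqr x : norm x ^+ 2 = \sum_(i < n) (tnth x i : R) ^+ 2.
Proof. by rewrite dist_sqr; apply: eq_bigr => i _; rewrite tnth_mktuple subr0. Qed.

Lemma abs_coord_le_dist x y i : `|(tnth x i : R) - tnth y i| <= euclidean_dist x y.
Proof.
rewrite -(@ler_pXn2r _ 2)// ?nnegrE ?dist_ge0// dist_sqr real_normK ?num_real//.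
by rewrite (bigD1 i)//= lerDl sumr_ge0// => j _; exact: sqr_ge0.
Qed.

Lemma dist_triangle y x z :
  euclidean_dist x z <= euclidean_dist x y + euclidean_dist y z.
Proof.
(* Lagrange's identity *)
have cauchy_schwarz (a b : 'I_n -> R) : (\sum_i a i * b i) ^+ 2 <=
    (\sum_i a i ^+ 2) * (\sum_i b i ^+ 2).
  have -> : (\sum_i a i * b i) ^+ 2 = \sum_i \sum_j (a i * b j) * (a j * b i).
    rewrite expr2 mulr_suml; apply: eq_bigr => i _.
    by rewrite mulr_sumr; apply: eq_bigr => j _; ring.
  have E1 : (\sum_i a i ^+ 2) * (\sum_i b i ^+ 2) = \sum_i \sum_j (a i * b j) ^+ 2.
    rewrite mulr_suml; apply: eq_bigr => i _.
    by rewrite mulr_sumr; apply: eq_bigr => j _; ring.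
  have E2 : (\sum_i a i ^+ 2) * (\sum_i b i ^+ 2) = \sum_i \sum_j (a j * b i) ^+ 2.
    by rewrite E1 exchange_big.
  rewrite -subr_ge0.
  have -> : (\sum_i a i ^+ 2) * (\sum_i b i ^+ 2)
      - \sum_i \sum_j (a i * b j) * (a j * b i) =
      2^-1 * \sum_i \sum_j (a i * b j - a j * b i) ^+ 2.
    have -> : \sum_i \sum_j (a i * b j - a j * b i) ^+ 2 =
        \sum_i \sum_j (a i * b j) ^+ 2 + \sum_i \sum_j (a j * b i) ^+ 2
        - 2 * \sum_i \sum_j (a i * b j) * (a j * b i).
      rewrite mulr_sumr -big_split -sumrB/=; apply: eq_bigr => i _.
      rewrite mulr_sumr -big_split -sumrB/=; apply: eq_bigr => j _; ring.
    by rewrite -E1 -E2; field.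
  rewrite mulr_ge0// ?invr_ge0//.
  by apply: sumr_ge0 => i _; apply: sumr_ge0 => j _; exact: sqr_ge0.
rewrite -(@ler_pXn2r _ 2)// ?nnegrE ?addr_ge0 ?dist_ge0//.
pose C := \sum_(i < n) ((tnth x i : R) - tnth y i) * ((tnth y i : R) - tnth z i).
have C_le : C <= euclidean_dist x y * euclidean_dist y z.
  apply: (le_trans (ler_norm _)).
  rewrite -(@ler_pXn2r _ 2)// ?nnegrE ?mulr_ge0 ?dist_ge0//.
  by rewrite real_normK ?num_real// exprMn !dist_sqr; exact: cauchy_schwarz.
have -> : euclidean_dist x z ^+ 2 =
    euclidean_dist x y ^+ 2 + euclidean_dist y z ^+ 2 + 2 * C.
  rewrite !dist_sqr mulr_sumr -!big_split/=; apply: eq_bigr => i _; ring.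
by rewrite sqrrD; lra.
Qed.

Lemma measurable_dist d (T : measurableType d) (f g : T -> euclidean R n) :
  measurable_fun setT f -> measurable_fun setT g ->
  measurable_fun setT (fun t => euclidean_dist (f t) (g t)).
Proof.
move=> mf mg; apply: (@measurableT_comp _ _ _ _ _ _ (@Num.sqrt R)).
  by apply: continuous_measurable_fun; exact: sqrt_continuous.
apply: measurable_sum => i; apply: measurable_funX.
by apply: measurable_funB; exact: measurable_tnthR.
Qed.

Lemma measurable_norm : measurable_fun setT (fun x => norm x).
Proof. by apply: measurable_dist; [exact: measurable_id|exact: measurable_cst]. Qed.

Lemma measurable_fun_setb d (T : measurableType d) (b : T -> bool) :
  measurable_fun setT b -> measurable [set x | b x].
Proof. by move=> mb; rewrite -[X in measurable X]setTI; exact: (mb measurableT [set true]). Qed.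

Lemma measurable_euclidean_ball (r : R) : measurable (euclidean_ball r : set (euclidean R n)).
Proof. by apply: measurable_fun_setb; apply: measurable_fun_ltr => //; exact: measurable_norm. Qed.

Lemma lebesgue_ball_le c (r : R) (A : set (euclidean R n)) : 0 <= r ->
  measurable A -> (forall y, A y -> euclidean_dist y c <= r) ->
  (lebesgue n A <= ((2 * r) ^+ n)%:E)%E.
Proof.
move=> r0 mA Ar; rewrite -(lebesgue_box c r0) le_measure ?inE//.
  exact: measurable_box.
move=> y /Ar yr i; exact: le_trans (abs_coord_le_dist _ _ _) yr.
Qed.

Lemma lebesgue_fin_num_in_ball (A : set (euclidean R n)) :
  measurable A -> A `<=` euclidean_ball 1 -> lebesgue n A \is a fin_num.
Proof.
move=> mA AB; have muA : (lebesgue n A <= ((2 * 1) ^+ n)%:E)%E.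
  apply: (@lebesgue_ball_le origin) => // y /AB.
  by rewrite /euclidean_ball/= -/origin => /ltW.
by rewrite ge0_fin_numE; [exact: le_lt_trans muA (ltry _)|exact: measure_ge0].
Qed.

(** The point reflection about x. *)
Definition antipode x y := mirror [tuple (2 * (tnth x i : R)) | i < n] y.

Lemma tnth_antipode x y i : tnth (antipode x y) i = 2 * (tnth x i : R) - tnth y i.
Proof. by rewrite tnth_mirror tnth_mktuple. Qed.

Lemma dist_antipode x y : euclidean_dist (antipode x y) x = euclidean_dist y x.
Proof.
by congr Num.sqrt; apply: eq_bigr => i _; rewrite tnth_antipode -sqrrN; congr (_ ^+ 2); ring.
Qed.

Lemma norm_antipode x y :
  `|norm y - norm (antipode x y)| <= 2 * euclidean_dist y x.
Proof.
have h := dist_antipode x y.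
have := dist_triangle (antipode x y) y origin.
have := dist_triangle y (antipode x y) origin.
have := dist_triangle x y (antipode x y).
rewrite (dist_sym x) (dist_sym (antipode x y) y) h ler_norml; lra.
Qed.

(** The points y near x such that neither y nor its reflection about x is strictly
    inside the sphere through x centred at the origin. They are the points at
    which the cancellation between y and its reflection fails. *)
Definition slab x (r : R) : set (euclidean R n) :=
  [set y | [&& euclidean_dist y x <= r, norm x <= norm y & norm x <= norm (antipode x y)]].

Lemma measurable_slab x (r : R) : measurable (slab x r).
Proof.
have md y : measurable_fun setT (fun t => euclidean_dist t y).
  by apply: measurable_dist; [exact: measurable_id|exact: measurable_cst].
apply: measurable_fun_setb; apply: measurable_and; last apply: measurable_and.
- exact: measurable_fun_ler.
- exact: measurable_fun_ler.
- apply: measurable_fun_ler => //.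
  by apply: measurable_dist; [exact: measurable_mirror|exact: measurable_cst].
Qed.

(** With h = y - x the two conditions read |h|^2 + 2 x.h >= 0 and
    |h|^2 - 2 x.h >= 0. *)
Lemma slab_inner x y (r : R) : 0 <= r -> slab x r y ->
  `|\sum_(i < n) (tnth x i : R) * ((tnth y i : R) - tnth x i)| <= r ^+ 2 / 2.
Proof.
move=> r0 /and3P[yr xy xa].
set W := \sum_(i < n) _.
have D_le : euclidean_dist y x ^+ 2 <= r ^+ 2 by rewrite ler_pXn2r ?nnegrE ?dist_ge0.
have xy2 : norm x ^+ 2 <= norm y ^+ 2 by rewrite ler_pXn2r ?nnegrE ?dist_ge0.
have xa2 : norm x ^+ 2 <= norm (antipode x y) ^+ 2.
  by rewrite ler_pXn2r ?nnegrE ?dist_ge0.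
have ny : norm y ^+ 2 = norm x ^+ 2 + 2 * W + euclidean_dist y x ^+ 2.
  rewrite !norm_sqr dist_sqr mulr_sumr -!big_split/=; apply: eq_bigr => i _; ring.
have na : norm (antipode x y) ^+ 2 = norm x ^+ 2 - 2 * W + euclidean_dist y x ^+ 2.
  rewrite !norm_sqr dist_sqr mulr_sumr -sumrB -!big_split/=; apply: eq_bigr => i _.
  by rewrite tnth_antipode; ring.
by rewrite ler_norml; lra.
Qed.

(** The translates of S by 0, v, ..., J v are pairwise disjoint and are contained in
    a common cube. This replaces coordinates adapted to the direction of v in the
    estimates of the measure of sets which are thin in that direction. *)
Lemma lebesgue_packing (S : set (euclidean R n)) c (v : 'I_n -> R) (r : R) (J : nat) :
  measurable S -> 0 <= r ->
  (forall k y z, (0 < k)%N -> S y -> S z ->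
    ~ forall i, (tnth y i : R) = (tnth z i : R) + k%:R * v i) ->
  (forall k y z, (k <= J)%N -> S z ->
    (forall i, (tnth y i : R) = (tnth z i : R) + k%:R * v i) -> box c r y) ->
  (J.+1%:R%:E * lebesgue n S <= ((2 * r) ^+ n)%:E)%E.
Proof.
move=> mS r0 disjS boxS.
pose w k : euclidean R n := [tuple k%:R * v i | i < n].
pose back k y := mirror origin (mirror (w k) y).
have backE k y i : (tnth y i : R) = (tnth (back k y) i : R) + k%:R * v i.
  by rewrite !tnth_mirror !tnth_mktuple; ring.
pose T k := back k @^-1` S.
have TE k : T k = mirror (w k) @^-1` (mirror origin @^-1` S) by [].
have mS' : measurable (mirror origin @^-1` S) by exact: measurable_mirror_preimage.
have mT k : measurable (T k) by rewrite TE; exact: measurable_mirror_preimage.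
have T_S k : lebesgue n (T k) = lebesgue n S by rewrite TE !lebesgue_mirror.
have tT : trivIset setT T.
  have lt_disj i j y : (i < j)%N -> T i y -> T j y -> False.
    move=> ij yi yj; apply: (disjS (j - i)%N (back i y) (back j y) _ yi yj).
      by rewrite subn_gt0.
    move=> k.
    have := backE i y k; have := backE j y k; rewrite natrB ?(ltnW ij)// mulrBl; lra.
  apply/trivIsetP => i j _ _ ij; rewrite -subset0 => y [yi yj].
  move: ij; rewrite neq_ltn => /orP[ij|ij].
    exact: (lt_disj _ _ _ ij yi yj).
  exact: (lt_disj _ _ _ ij yj yi).
have : (\sum_(k < J.+1) lebesgue n (T k) <= lebesgue n (box c r))%E.
  rewrite -measure_semi_additive_ord_I//.
  - apply: le_measure; rewrite ?inE//.
    + exact: bigsetU_measurable.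
    + exact: measurable_box.
    + by rewrite -bigcup_mkord => y [k /= kJ] /boxS; apply; [|exact: backE].
  - exact: sub_trivIset tT.
  - exact: bigsetU_measurable.
rewrite (eq_bigr (fun=> lebesgue n S)) ?T_S//.
by rewrite sumr_const card_ord mule_natl lebesgue_box.
Qed.

(** The slab has width r^2/|x| <= 2 r^2 in the direction of x, so about 1/r of its
    translates fit disjointly into a cube of side 4 r. *)
Lemma lebesgue_slab_le x (r : R) : 0 < r -> r <= 1 -> 2^-1 <= norm x ->
  (lebesgue n (slab x r) <= ((4 * r) ^+ n.+1)%:E)%E.
Proof.
move=> r0 r1 x2.
pose nx2 := norm x ^+ 2.
have nx2_gt0 : 0 < nx2 by rewrite exprn_gt0//; lra.
(* tau is such that x.(tau x) = 2 r^2, twice the range of x.h on the slab *)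
pose tau := 2 * r ^+ 2 / nx2.
have tau0 : 0 <= tau.
  by apply: divr_ge0; [apply: mulr_ge0 => //; exact: sqr_ge0|exact: ltW].
pose J := Num.truncn (4 * r)^-1.
have r4_gt0 : 0 < (4 * r)^-1 by rewrite invr_gt0; lra.
have [J_le J_lt] : J%:R <= (4 * r)^-1 /\ (4 * r)^-1 < J.+1%:R.
  by have /andP := truncn_itv (ltW r4_gt0).
have r2 : 0 < r ^+ 2 by rewrite exprn_gt0.
have : (J.+1%:R%:E * lebesgue n (slab x r) <= ((2 * (2 * r)) ^+ n)%:E)%E.
  apply: (@lebesgue_packing _ x (fun i => tau * (tnth x i : R))).
  - exact: measurable_slab.
  - lra.
  - move=> k y z k0 /(slab_inner (ltW r0)) yi /(slab_inner (ltW r0)) zi yz.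
    have : \sum_(i < n) (tnth x i : R) * ((tnth y i : R) - tnth x i) =
        \sum_(i < n) (tnth x i : R) * ((tnth z i : R) - tnth x i)
        + k%:R * (2 * r ^+ 2).
      have -> : 2 * r ^+ 2 = tau * nx2 by rewrite /tau mulfVK// gt_eqF.
      rewrite /nx2 norm_sqr !mulr_sumr -big_split; apply: eq_bigr => i _ /=.
      by rewrite yz; ring.
    have : 1 * (2 * r ^+ 2) <= k%:R * (2 * r ^+ 2).
      by rewrite ler_wpM2r ?ler1n//; lra.
    move: yi zi; rewrite !ler_norml; lra.
  - move=> k y z kJ /and3P[zr _ _] yz i.
    have {}zr := le_trans (abs_coord_le_dist _ _ i) zr.
    have kr : k%:R * (4 * r) <= 1.
      rewrite -ler_pdivlMr ?mul1r; last lra.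
      by rewrite (le_trans _ J_le)// ler_nat.
    have taux : `|tau * (tnth x i : R)| <= 4 * r ^+ 2.
      rewrite normrM (ger0_norm tau0).
      have := abs_coord_le_dist x origin i; rewrite tnth_mktuple subr0 => xi.
      apply: (le_trans (ler_wpM2l tau0 xi)).
      rewrite /tau /nx2 mulrAC ler_pdivrMr// expr2.
      by nra.
    have ktau : `|k%:R * (tau * (tnth x i : R))| <= r.
      rewrite normrM ger0_norm//; apply: le_trans (ler_wpM2l _ taux) _ => //; nra.
    by move: zr ktau; rewrite yz !ler_norml; lra.
rewrite (_ : 2 * (2 * r) = 4 * r); last lra.
move=> h; rewrite exprS EFinM -lee_pdivrMl; last lra.
apply: le_trans h; rewrite lee_wpmul2r//.
by rewrite lee_fin ltW.
Qed.

End distance.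

(** * Integrals of the singular kernel over shells *)

Section riesz.
Context {R : realType} {n : nat}.
Variables q sigma : R.
Hypothesis q_ge0 : 0 <= q.
Hypothesis sigma_gt0 : 0 < sigma.
Hypothesis q_sigma : q + sigma = n.+1%:R.
Implicit Types x y : euclidean R n.

Local Notation norm x := (euclidean_dist x origin).
Local Notation mu := (lebesgue n : set (euclidean R n) -> \bar R).

Definition riesz x y : R := (euclidean_dist x y `^ q)^-1.

Lemma riesz_ge0 x y : 0 <= riesz x y.
Proof. by rewrite invr_ge0 powR_ge0. Qed.

Lemma riesz_sym x y : riesz x y = riesz y x.
Proof. by rewrite /riesz dist_sym. Qed.

Lemma riesz_le x y (r : R) : 0 < r -> r <= euclidean_dist x y ->
  riesz x y <= (r `^ q)^-1.
Proof.
move=> r0 ry; have d0 := lt_le_trans r0 ry.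
rewrite lef_pV2 ?posrE ?powR_gt0//.
by apply: ge0_ler_powR => //; rewrite nnegrE ltW.
Qed.

Lemma measurable_riesz d (T : measurableType d) (f g : T -> euclidean R n) :
  measurable_fun setT f -> measurable_fun setT g ->
  measurable_fun setT (fun t => riesz (f t) (g t)).
Proof.
move=> mf mg; rewrite /riesz.
under eq_fun do rewrite -powRN.
apply: (@measurableT_comp _ _ _ _ _ _ (fun t : R => t `^ (- q))).
  exact: measurable_powR.
exact: measurable_dist.
Qed.

Definition shell x (a b : R) : set (euclidean R n) :=
  [set y | a <= euclidean_dist x y < b].

Lemma measurable_shell x a b : measurable (shell x a b).
Proof.
have md : measurable_fun setT (fun y => euclidean_dist x y).
  by apply: measurable_dist; [exact: measurable_cst|exact: measurable_id].
by apply: measurable_fun_setb; apply: measurable_and;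
  [exact: measurable_fun_ler|exact: measurable_fun_ltr].
Qed.

Definition cball x (r : R) : set (euclidean R n) := [set y | euclidean_dist x y <= r].

Lemma measurable_cball x (r : R) : measurable (cball x r).
Proof.
apply: measurable_fun_setb; apply: measurable_fun_ler => //.
by apply: measurable_dist; [exact: measurable_cst|exact: measurable_id].
Qed.

Section dyadic.
Variables (x : euclidean R n) (g : euclidean R n -> R) (C rho0 : R).
Hypothesis mg : measurable_fun setT g.
Hypothesis C_ge0 : 0 <= C.
Hypothesis g_ge0 : forall y, 0 <= g y.
Hypothesis g_growth : forall r, 0 < r -> r <= rho0 ->
  (\int[mu]_(y in cball x r) (g y)%:E <= (C * r ^+ n.+1)%:E)%E.

Let mgk : measurable_fun setT (fun y => (g y * riesz x y)%:E).
Proof.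
apply/measurable_EFinP; apply: measurable_funM => //.
by apply: measurable_riesz; [exact: measurable_cst|exact: measurable_id].
Qed.

Let gk_ge0 y : (0 <= (g y * riesz x y)%:E)%E.
Proof. by rewrite lee_fin mulr_ge0// riesz_ge0. Qed.

Let one_shell (rho : R) : 0 < rho -> rho <= rho0 ->
  (\int[mu]_(y in shell x (rho / 2) rho) (g y * riesz x y)%:E <=
   (C * 2 `^ q * rho `^ sigma)%:E)%E.
Proof.
move=> r0 rr0; pose M := ((rho / 2) `^ q)^-1.
have M0 : 0 <= M by rewrite invr_ge0 powR_ge0.
apply: (@le_trans _ _ (\int[mu]_(y in shell x (rho / 2) rho) (M%:E * (g y)%:E))%E).
  apply: ge0_le_integral => //.
  - exact: measurable_shell.
  - exact: measurable_funTS.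
  - apply: measurable_funTS; under eq_fun do rewrite -EFinM.
    by apply/measurable_EFinP; exact: measurable_funM.
  - move=> y /= /andP[ry _]; rewrite -EFinM lee_fin mulrC ler_wpM2r//.
    by apply: riesz_le => //; lra.
rewrite ge0_integralZl//; last 3 first.
- exact: measurable_shell.
- by apply: measurable_funTS; exact/measurable_EFinP.
- by move=> y _; rewrite lee_fin.
apply: (@le_trans _ _ (M%:E * (C * rho ^+ n.+1)%:E)%E).
  rewrite lee_wpmul2l// ?lee_fin//; apply: le_trans (g_growth r0 rr0).
  apply: ge0_subset_integral => //.
  - exact: measurable_shell.
  - exact: measurable_cball.
  - by apply: measurable_funTS; exact/measurable_EFinP.
  - by move=> y _; rewrite lee_fin.
  - by move=> y /= /andP[_ /ltW].
have -> : rho ^+ n.+1 = rho `^ q * rho `^ sigma.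
  by rewrite -powR_mulrn -?q_sigma ?powRD ?(gt_eqF r0) ?implybT// ltW.
have -> : M = 2 `^ q / rho `^ q.
  rewrite /M powRM ?invr_ge0// ?(ltW r0)// invfM mulrC.
  by rewrite -[2^-1]powR_inv1// -powRrM mulN1r powRN invrK.
have rq : rho `^ q != 0 by rewrite gt_eqF// powR_gt0.
by rewrite -EFinM lee_fin le_eqVlt; apply/orP; left; apply/eqP; field.
Qed.

Definition dyadic_cst : R := 2 `^ q / (1 - 2^-1 `^ sigma).

Let half_powR_lt1 : 2^-1 `^ sigma < 1 :> R.
Proof.
have : 2^-1 `^ sigma < 1 `^ sigma :> R.
  by apply: gt0_ltr_powR => //; rewrite ?nnegrE ?invr_ge0// invf_lt1// ltr1n.
by rewrite powR1.
Qed.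

Lemma dyadic_cst_ge0 : 0 <= dyadic_cst.
Proof. by rewrite divr_ge0 ?powR_ge0// subr_ge0 ltW. Qed.

(** The weight g gains one power of r over the volume growth r^n, hence the integral
    over the shell between rho/2 and rho is O(rho^sigma), and these bounds form a
    convergent geometric series over the dyadic shells. The bound is uniform in
    eps. *)
Lemma integral_shell_le (eps : R) : 0 < eps -> 0 < rho0 ->
  (\int[mu]_(y in shell x eps rho0) (g y * riesz x y)%:E <=
   (C * dyadic_cst * rho0 `^ sigma)%:E)%E.
Proof.
move=> eps0 rho00.
have dyadic m (rho : R) : 0 < rho -> rho <= rho0 ->
    (\int[mu]_(y in shell x (rho / 2 ^+ m) rho) (g y * riesz x y)%:E <=
     (C * dyadic_cst * rho `^ sigma)%:E)%E.
  (* dyadic_cst is the fixed point of D |-> 2 `^ q + 2^-1 `^ sigma * D, so the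
     bound reproduces itself when the shell is extended by one dyadic layer *)
  elim: m => [|m IH] in rho * => r0 rr0.
    rewrite expr0 divr1 (_ : shell x rho rho = set0) ?integral_set0 ?lee_fin//.
      by apply: mulr_ge0; [exact: mulr_ge0 C_ge0 dyadic_cst_ge0|exact: powR_ge0].
    by rewrite -subset0 => y /andP[/le_lt_trans h /h]; rewrite ltxx.
  rewrite (_ : shell x (rho / 2 ^+ m.+1) rho =
    shell x (rho / 2 / 2 ^+ m) (rho / 2) `|` shell x (rho / 2) rho); last first.
    rewrite exprS invfM mulrA.
    have h : rho / 2 / 2 ^+ m <= rho / 2.
      by rewrite ler_pdivrMr ?exprn_gt0// ler_peMr ?exprn_ege1//; lra.
    apply/seteqP; split => y; rewrite /shell/=.
      move=> /andP[h1 h2]; case: (ltP (euclidean_dist x y) (rho / 2)) => h3.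
        by left; apply/andP.
      by right; apply/andP.
    by case => /andP[h1 h2]; apply/andP; split; lra.
  rewrite ge0_integral_setU//; last 4 first.
  - exact: measurable_shell.
  - exact: measurable_shell.
  - exact: measurable_funTS.
  - rewrite disj_set2E; apply/eqP; rewrite -subset0 => y [/= /andP[_ h1] /andP[h2 _]].
    by move: h1; rewrite ltNge h2.
  have r20 : 0 < rho / 2 by lra.
  have r2r : rho / 2 <= rho0 by lra.
  apply: le_trans (leeD (IH _ r20 r2r) (one_shell r0 rr0)) _.
  rewrite -EFinD lee_fin powRM ?invr_ge0// ?(ltW r0)// /dyadic_cst.
  rewrite le_eqVlt; apply/orP; left; apply/eqP; field.
  by rewrite subr_eq0 gt_eqF.
pose m := Num.truncn (rho0 / eps).
have m_gt : rho0 / eps < m.+1%:R.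
  by have /andP[] := truncn_itv (ltW (divr_gt0 rho00 eps0)).
apply: le_trans (dyadic m rho0 rho00 (lexx _)).
apply: ge0_subset_integral => //.
- exact: measurable_shell.
- exact: measurable_shell.
- exact: measurable_funTS.
- move=> y /= /andP[h1 h2]; apply/andP; split=> //; apply: le_trans h1.
  rewrite ler_pdivrMr ?exprn_gt0// mulrC -ler_pdivrMr//.
  by rewrite (le_trans (ltW m_gt))// -natrX ler_nat ltn_expl.
Qed.

End dyadic.
End riesz.

(** * The radial flow and its balance at a point *)

Section calibration.
Context {R : realType} {n : nat}.
Variables q sigma : R.
Hypothesis q_ge0 : 0 <= q.
Hypothesis sigma_gt0 : 0 < sigma.
Hypothesis q_sigma : q + sigma = n.+1%:R.
Implicit Types x y : euclidean R n.

Local Notation norm x := (euclidean_dist x origin).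
Local Notation mu := (lebesgue n : set (euclidean R n) -> \bar R).
Local Notation kern := (@riesz R n q).

(** Spheres of radius less than 1/2 must not be used: their curvature is unbounded. *)
Definition cutoff x : R := Num.min 1 (Num.max 0 (4 * norm x - 2)).

Lemma cutoff_itv x : 0 <= cutoff x <= 1.
Proof. by rewrite /cutoff le_min ge_min le_max !lexx ler01. Qed.

Lemma cutoff0 x : norm x <= 2^-1 -> cutoff x = 0.
Proof. by move=> h; rewrite /cutoff max_l ?min_r//; lra. Qed.

Lemma cutoff1 x : 3 / 4 <= norm x -> cutoff x = 1.
Proof. by move=> h; rewrite /cutoff max_r ?min_l//; lra. Qed.

Lemma cutoff_lipschitz x y : cutoff x - cutoff y <= 4 * `|norm x - norm y|.
Proof.
have h1 := ler_norm (norm x - norm y); have h2 := normr_ge0 (norm x - norm y).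
rewrite lerBlDr /cutoff ge_min; apply/orP.
have [h3|h3] := leP 0 (4 * norm y - 2); have [h4|h4] := leP 1 (4 * norm y - 2).
- by left; lra.
- by right; rewrite ge_max; apply/andP; split; lra.
- lra.
- by right; rewrite min_r// ge_max; apply/andP; split; lra.
Qed.

Lemma measurable_cutoff : measurable_fun setT cutoff.
Proof.
apply: measurable_minr => //; apply: measurable_maxr => //.
apply: measurable_funB => //; apply: measurable_funM => //; exact: measurable_norm.
Qed.

Variables eps rho : R.

(** The flow from x towards the inner concentric spheres, truncated at small and at
    large distances. *)
Definition radial_flow x y : R :=
  if (norm y < norm x) && (eps <= euclidean_dist x y < rho)
  then cutoff x * cutoff y * kern x y else 0.

Lemma radial_flow_ge0 x y : 0 <= radial_flow x y.
Proof.
rewrite /radial_flow; case: ifP => // _.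
have /andP[x0 _] := cutoff_itv x; have /andP[y0 _] := cutoff_itv y.
by rewrite !mulr_ge0// riesz_ge0.
Qed.

Lemma measurable_radial_flow d (T : measurableType d) (f g : T -> euclidean R n) :
  measurable_fun setT f -> measurable_fun setT g ->
  measurable_fun setT (fun t => radial_flow (f t) (g t)).
Proof.
move=> mf mg.
have mn h : measurable_fun setT h -> measurable_fun setT (fun t : T => norm (h t)).
  by move=> mh; apply: measurable_dist => //; exact: measurable_cst.
have mc h : measurable_fun setT h -> measurable_fun setT (fun t : T => cutoff (h t)).
  by move=> mh; apply: measurableT_comp => //; exact: measurable_cutoff.
apply: measurable_fun_ifT => //.
  apply: measurable_and.
    by apply: measurable_fun_ltr; exact: mn.
  by apply: measurable_and;
    [apply: measurable_fun_ler|apply: measurable_fun_ltr] => //; exact: measurable_dist.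
apply: measurable_funM; last exact: measurable_riesz.
by apply: measurable_funM; exact: mc.
Qed.

(** The failure of the cancellation between y and its reflection about x, relative to
    the kernel. The first term comes from the cut-off, which is 4-Lipschitz, since y
    and its reflection are at distance 2 |x-y|; the second one comes from the
    curvature of the sphere through x. *)
Definition defect x y : R :=
  8 * euclidean_dist x y + (2^-1 <= norm x)%R%:R * \1_(slab x rho) y.

Lemma defect_ge0 x y : 0 <= defect x y.
Proof. by rewrite addr_ge0// mulr_ge0// dist_ge0. Qed.

Lemma measurable_defect x : measurable_fun setT (defect x).
Proof.
apply: measurable_funD; apply: measurable_funM => //.
  by apply: measurable_dist; [exact: measurable_cst|exact: measurable_id].
by apply: measurable_indic; exact: measurable_slab.
Qed.

(** If y is strictly outside the sphere through x, then either its reflection is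
    strictly inside and receives from x what x receives from y, up to the variation
    of the cut-off, or y belongs to the slab. *)
Lemma radial_flow_antipode_le x y : radial_flow y x <= radial_flow x (antipode x y) +
  (if eps <= euclidean_dist x y < rho then defect x y * kern x y else 0).
Proof.
have dxa : euclidean_dist x (antipode x y) = euclidean_dist x y.
  by rewrite dist_sym dist_antipode dist_sym.
have kxa : kern x (antipode x y) = kern x y by rewrite /riesz dxa.
rewrite {1}/radial_flow [euclidean_dist y x]dist_sym.
have [xy|_] := ltP; last first.
  apply: addr_ge0; first exact: radial_flow_ge0.
  case: ifP => _; last exact: lexx.
  by apply: mulr_ge0; [exact: defect_ge0|exact: riesz_ge0].
have [er|_] := boolP (_ <= _ < _); last by rewrite addr0 radial_flow_ge0.
have k0 := riesz_ge0 q x y.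
have /andP[x0 x1] := cutoff_itv x; have /andP[y0 y1] := cutoff_itv y.
rewrite /= /radial_flow dxa er andbT kxa [kern y x]riesz_sym.
have [ax|xa] := ltP.
  rewrite -mulrDl ler_wpM2r//.
  have := cutoff_lipschitz y (antipode x y); have := norm_antipode x y.
  rewrite [euclidean_dist y x]dist_sym => h1 h2.
  have : cutoff x * (cutoff y - cutoff (antipode x y)) <= 8 * euclidean_dist x y.
    apply: (@le_trans _ _ (cutoff x * (8 * euclidean_dist x y))).
      by rewrite ler_wpM2l//; lra.
    by rewrite ler_piMl// mulr_ge0// dist_ge0.
  have : 0 <= (2^-1 <= norm x)%R%:R * \1_(slab x rho) y :> R by rewrite mulr_ge0.
  rewrite /defect; lra.
rewrite add0r ler_wpM2r//.
have d0 := dist_ge0 x y.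
have [x2|x2] := leP (2^-1) (norm x); last first.
  by rewrite (cutoff0 (ltW x2)) mulr0 defect_ge0.
rewrite /defect x2 mul1r indicE mem_set; last first.
  apply/and3P; split; [|exact: ltW xy|exact: xa].
  by rewrite dist_sym; case/andP: er => _ /ltW.
have : cutoff y * cutoff x <= 1 by rewrite mulr_ile1.
by rewrite /=; lra.
Qed.

Definition curvature_cst : R := 5 * 4 ^+ n.+1 * dyadic_cst q sigma.

Lemma defect_growth x (r : R) : 0 < r -> r <= rho -> rho <= 1 ->
  (\int[mu]_(y in cball x r) (defect x y)%:E <= (5 * 4 ^+ n.+1 * r ^+ n.+1)%:E)%E.
Proof.
move=> r0 rr r1.
have mc := measurable_cball x r.
apply: (@le_trans _ _ (\int[mu]_(y in cball x r)
    ((8 * r)%:E + ((2^-1 <= norm x)%R%:R * \1_(slab x rho) y)%:E))%E).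
  apply: ge0_le_integral => //.
  - by move=> y _; rewrite lee_fin defect_ge0.
  - by apply: measurable_funTS; apply/measurable_EFinP; exact: measurable_defect.
  - apply: measurable_funTS; under eq_fun do rewrite -EFinD.
    apply/measurable_EFinP; apply: measurable_funD => //; apply: measurable_funM => //.
    by apply: measurable_indic; exact: measurable_slab.
  - by move=> y; rewrite /cball/= => yr; rewrite -EFinD lee_fin lerD2r ler_wpM2l.
rewrite ge0_integralD//; last 2 first.
- by move=> y _; rewrite lee_fin mulr_ge0// ltW.
- apply: measurable_funTS; apply/measurable_EFinP; apply: measurable_funM => //.
  by apply: measurable_indic; exact: measurable_slab.
apply: (@le_trans _ _ (((8 * r) * (2 * r) ^+ n)%:E + ((4 * r) ^+ n.+1)%:E)%E).
  apply: leeD.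
    rewrite integral_cst// [leRHS]EFinM lee_wpmul2l//; first by rewrite lee_fin; lra.
    apply: (@lebesgue_ball_le _ _ x) => //; first exact: ltW.
    by move=> y; rewrite /cball/= dist_sym.
  have [x2|x2] := boolP (2^-1 <= norm x); last first.
    rewrite (eq_integral (cst 0)%E) ?integral0; last by move=> y _; rewrite mul0r.
    by rewrite lee_fin exprn_ge0//; lra.
  under eq_integral do rewrite mul1r.
  rewrite integral_indic//; last exact: measurable_slab.
  apply: le_trans (lebesgue_slab_le r0 (le_trans rr r1) x2).
  apply: le_measure; rewrite ?inE.
  - by apply: measurableI => //; exact: measurable_slab.
  - exact: measurable_slab.
  - by move=> y [/and3P[_ h1 h2] yr]; apply/and3P; split; rewrite // dist_sym.
rewrite -EFinD lee_fin !exprMn.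
have -> : 8 * r * (2 ^+ n * r ^+ n) = 4 * 2 ^+ n.+1 * r ^+ n.+1.
  by rewrite !exprS; ring.
rewrite -mulrDl ler_wpM2r ?exprn_ge0 ?(ltW r0)//.
have : 2 ^+ n.+1 <= 4 ^+ n.+1 :> R by rewrite lerXn2r ?nnegrE ?ler_nat.
lra.
Qed.

(** A bound on the nonlocal mean curvature of the sphere through x, seen at distances
    less than rho. The reflection about x turns incoming into outgoing flow. *)
Lemma radial_flow_balance x : 0 < eps -> 0 < rho -> rho <= 1 ->
  (\int[mu]_y (radial_flow y x)%:E <=
   \int[mu]_y (radial_flow x y)%:E + (curvature_cst * rho `^ sigma)%:E)%E.
Proof.
move=> eps0 r0 r1.
pose err y := if eps <= euclidean_dist x y < rho then defect x y * kern x y else 0.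
have err_ge0 y : 0 <= err y.
  by rewrite /err; case: ifP => // _; rewrite mulr_ge0 ?defect_ge0 ?riesz_ge0.
have merr : measurable_fun setT err.
  apply: measurable_fun_ifT => //.
    apply: measurable_and;
    [apply: measurable_fun_ler|apply: measurable_fun_ltr] => //;
    by apply: measurable_dist; [exact: measurable_cst|exact: measurable_id].
  apply: measurable_funM; first exact: measurable_defect.
  by apply: measurable_riesz; [exact: measurable_cst|exact: measurable_id].
have mxy : measurable_fun setT (fun y => (radial_flow x y)%:E).
  by apply/measurable_EFinP; apply: measurable_radial_flow;
    [exact: measurable_cst|exact: measurable_id].
have mxa : measurable_fun setT (fun y => (radial_flow x (antipode x y))%:E).
  by apply/measurable_EFinP; apply: measurable_radial_flow;
    [exact: measurable_cst|exact: measurable_mirror].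
have flow0 a b : (0 <= (radial_flow a b)%:E)%E by rewrite lee_fin radial_flow_ge0.
have errE0 y : (0 <= (err y)%:E)%E by rewrite lee_fin.
have merrE : measurable_fun setT (fun y => (err y)%:E) by exact/measurable_EFinP.
have myx : measurable_fun setT (fun y => (radial_flow y x)%:E).
  by apply/measurable_EFinP; apply: measurable_radial_flow;
    [exact: measurable_id|exact: measurable_cst].
have le_pointwise y : [set: euclidean R n] y -> ((radial_flow y x)%:E <=
    (radial_flow x (antipode x y))%:E + (err y)%:E)%E.
  by move=> _; rewrite -EFinD lee_fin radial_flow_antipode_le.
apply: (le_trans (ge0_le_integral _ measurableT (fun y _ => flow0 y x) myx
  (emeasurable_funD mxa merrE) le_pointwise)).
rewrite (ge0_integralD _ measurableT (fun y _ => flow0 x (antipode x y)) mxa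
  (fun y _ => errE0 y) merrE).
have mirrored : (\int[mu]_y (radial_flow x (antipode x y))%:E =
  \int[mu]_y (radial_flow x y)%:E)%E := integral_mirror _ mxy (flow0 x).
rewrite mirrored; apply: leeD2l.
have := integral_shell_le q_ge0 sigma_gt0 q_sigma (measurable_defect x) _
  (@defect_ge0 x) (fun r r0 rr => defect_growth x r0 rr r1) eps0 r0.
have -> : (\int[mu]_(y in shell x eps rho) (defect x y * kern x y)%:E =
    \int[mu]_y (err y)%:E)%E.
  rewrite integral_mkcond; apply: eq_integral => y _.
  rewrite /patch /err; case: ifPn => [|]; rewrite ?inE ?notin_setE /shell/=.
    by move=> ->.
  by move=> /negP/negbTE ->.
by rewrite /curvature_cst; apply; rewrite mulr_ge0.
Qed.

End calibration.

(** * The half shell has small measure *)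

Section half_shell.
Context {R : realType} {n : nat}.
Local Notation norm x := (euclidean_dist x origin).

Lemma measurable_half_shell (delta : R) :
  measurable (half_shell delta : set (euclidean R n.+1)).
Proof.
apply: measurableI; first apply: measurableD.
- exact: measurable_euclidean_ball.
- exact: measurable_euclidean_ball.
- by apply: measurable_fun_setb; apply: measurable_fun_ltr => //; exact: measurable_tnthR.
Qed.

(** Moving a point of the lower half space down by t increases the square of its norm
    by at least t^2. Hence the translates of the half shell by multiples of t are
    disjoint as soon as (1 + delta)^2 < 1 + t^2. *)
Lemma lebesgue_half_shell_small (kappa : R) : 0 < kappa ->
  exists delta0 : R, [/\ 0 < delta0, delta0 <= 1 & forall delta, 0 < delta -> delta <= delta0 ->
    (lebesgue n.+1 (half_shell delta : set (euclidean R n.+1)) <= kappa%:E)%E].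
Proof.
move=> k0; pose V : R := (2 * 3) ^+ n.+1.
pose J := Num.truncn (V / kappa).
have V0 : 0 < V / kappa by rewrite divr_gt0// exprn_gt0.
have J_gt : V / kappa < J.+1%:R by have /andP[] := truncn_itv (ltW V0).
(* J + 1 translates by multiples of tau stay in the cube of half side 3 *)
pose tau : R := J.+1%:R^-1.
have tau0 : 0 < tau by rewrite invr_gt0.
have tau1 : tau <= 1 by rewrite invf_le1// ler1n.
exists (tau ^+ 2 / 4); split; [by rewrite divr_gt0// exprn_gt0|nra|].
move=> delta d0 d1.
pose v (i : 'I_n.+1) : R := if i == ord_max then - tau else 0.
have : (J.+1%:R%:E * lebesgue n.+1 (half_shell delta : set (euclidean R n.+1)) <=
    ((2 * 3) ^+ n.+1)%:E)%E.
  apply: (@lebesgue_packing _ _ _ origin v) => //.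
  - exact: measurable_half_shell.
  - move=> k y z kpos [[]]; rewrite /euclidean_ball/= -/origin => yd _ _.
    move=> [[_ /negP]]; rewrite -/origin -leNgt => z1 zneg yz.
    have yz2 : norm y ^+ 2 =
        norm z ^+ 2 - 2 * (k%:R * tau) * (tnth z ord_max : R) + (k%:R * tau) ^+ 2.
      rewrite !norm_sqr (bigD1 ord_max)//= [in RHS](bigD1 ord_max)//= yz /v eqxx.
      rewrite (eq_bigr (fun i => (tnth z i : R) ^+ 2)); first ring.
      by move=> i /negbTE imax; rewrite yz /v imax mulr0 addr0.
    have ktau : tau <= k%:R * tau by rewrite ler_peMl ?ler1n// ltW.
    have : norm y ^+ 2 < (1 + delta) ^+ 2 by rewrite ltr_pXn2r ?nnegrE ?dist_ge0//; lra.
    have : 1 <= norm z ^+ 2 by rewrite exprn_ege1.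
    have : tau ^+ 2 <= (k%:R * tau) ^+ 2 by rewrite ler_pXn2r ?nnegrE//; lra.
    have : (1 + delta) ^+ 2 < 1 + tau ^+ 2.
      have : 0 < tau ^+ 2 by rewrite exprn_gt0.
      have : tau ^+ 2 <= 1 by rewrite exprn_ile1// ltW.
      by move: d0 d1; rewrite sqrrD; nra.
    have : 0 <= k%:R * tau * - (tnth z ord_max : R).
      by rewrite mulr_ge0 ?oppr_ge0 ?(ltW zneg)//; lra.
    by rewrite yz2; lra.
  - move=> k y z kJ [[]]; rewrite /euclidean_ball/= -/origin => zd _ _ yz i.
    have := le_lt_trans (abs_coord_le_dist z origin i) zd.
    rewrite yz !tnth_mktuple !subr0 => zi.
    have ktau : k%:R * tau <= 1 by rewrite ler_pdivrMr ?mul1r ?ler_nat ?(leq_trans kJ).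
    have vi : `|v i| <= tau by rewrite /v; case: ifP; rewrite ?normrN ?normr0 ?gtr0_norm// ltW.
    have : `|k%:R * v i| <= 1.
      by rewrite normrM ger0_norm// (le_trans _ ktau)// ler_wpM2l.
    have := ler_normD (tnth z i : R) (k%:R * v i); nra.
move=> h; rewrite -(@lee_pmul2l _ J.+1%:R%:E)//.
apply: le_trans h _; rewrite -EFinM lee_fin -/V.
by rewrite -ler_pdivrMr// ltW.
Qed.

End half_shell.

(** * Iterated integrals and abstract calibrations *)

Section iterated_integral.
Context d (T : measurableType d) (R : realType).
Variables (mu : {sigma_finite_measure set T -> \bar R}) (k : T -> T -> R).
Hypothesis mk : measurable_fun setT (fun z : T * T => k z.1 z.2).
Hypothesis k_ge0 : forall x y, 0 <= k x y.
Implicit Types A B C : set T.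
Local Open Scope ereal_scope.

Definition iint A B := \int[mu]_(x in A) \int[mu]_(y in B) (k x y)%:E.

Let mkE : measurable_fun setT (fun z : T * T => (k z.1 z.2)%:E).
Proof. exact/measurable_EFinP. Qed.

Lemma measurable_kernel_section x : measurable_fun setT (fun y => (k x y)%:E).
Proof. exact: (measurable_fun_pair2 x mkE). Qed.

Lemma inner_ge0 B x : 0 <= \int[mu]_(y in B) (k x y)%:E.
Proof. by apply: integral_ge0 => y _; rewrite lee_fin. Qed.

Lemma iint_ge0 A B : 0 <= iint A B.
Proof. by apply: integral_ge0 => x _; exact: inner_ge0. Qed.

Lemma measurable_inner B : measurable B ->
  measurable_fun setT (fun x => \int[mu]_(y in B) (k x y)%:E).
Proof.
move=> mB; pose f := (fun z : T * T => (k z.1 z.2)%:E) \_ (setT `*` B).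
have mf : measurable_fun setT f.
  by apply/(measurable_restrictT _ _).1; [exact: measurableX|exact: measurable_funTS].
rewrite [X in measurable_fun _ X](_ : _ = fubini_F mu f).
  apply: measurable_fun_fubini_tonelli_F => //.
  by move=> z; apply: erestrict_ge0 => ? _; rewrite lee_fin.
apply/funext => x; rewrite /fubini_F [LHS]integral_mkcond; apply: eq_integral => y _.
by rewrite /f /patch in_setX in_setT.
Qed.

Lemma iintE A B : measurable A -> measurable B ->
  \int[mu \x mu]_(z in A `*` B) (k z.1 z.2)%:E = iint A B.
Proof.
move=> mA mB; rewrite [LHS]integral_mkcond fubini_tonelli1; last 2 first.
- by apply/(measurable_restrictT _ _).1; [exact: measurableX|exact: measurable_funTS].
- by move=> z; apply: erestrict_ge0 => ? _; rewrite lee_fin.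
rewrite /iint [RHS]integral_mkcond; apply: eq_integral => x _.
rewrite /fubini_F /patch; case: ifPn => xA.
  rewrite [RHS]integral_mkcond; apply: eq_integral => y _.
  by rewrite /patch in_setX xA.
by rewrite integral0_eq// => y _; rewrite in_setX (negbTE xA).
Qed.

Lemma iint_swap A B : measurable A -> measurable B ->
  iint A B = \int[mu]_(y in B) \int[mu]_(x in A) (k x y)%:E.
Proof.
move=> mA mB; rewrite -iintE// [LHS]integral_mkcond fubini_tonelli2; last 2 first.
- by apply/(measurable_restrictT _ _).1; [exact: measurableX|exact: measurable_funTS].
- by move=> z; apply: erestrict_ge0 => ? _; rewrite lee_fin.
rewrite [RHS]integral_mkcond; apply: eq_integral => y _.
rewrite /fubini_G /patch; case: ifPn => yB.
  rewrite [RHS]integral_mkcond; apply: eq_integral => x _.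
  by rewrite /patch in_setX yB andbT.
by rewrite integral0_eq// => x _; rewrite in_setX (negbTE yB) andbF.
Qed.

Lemma iint_setUr A B C : measurable A -> measurable B -> measurable C ->
  [disjoint B & C] -> iint A (B `|` C) = iint A B + iint A C.
Proof.
move=> mA mB mC BC; rewrite /iint -ge0_integralD//; last 4 first.
- by move=> x _; exact: inner_ge0.
- exact/measurable_funTS/measurable_inner.
- by move=> x _; exact: inner_ge0.
- exact/measurable_funTS/measurable_inner.
apply: eq_integral => x _; rewrite ge0_integral_setU//.
  exact/measurable_funTS/measurable_kernel_section.
by move=> y _; rewrite lee_fin.
Qed.

Lemma iint_setUl A B C : measurable A -> measurable B -> measurable C ->
  [disjoint A & B] -> iint (A `|` B) C = iint A C + iint B C.
Proof.
move=> mA mB mC AB; rewrite /iint ge0_integral_setU//.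
  exact/measurable_funTS/measurable_inner.
by move=> x _; exact: inner_ge0.
Qed.

Lemma iint_le_ae A B C : measurable A -> measurable B -> measurable C ->
  mu (B `\` C) = 0 -> iint A B <= iint A C.
Proof.
move=> mA mB mC BC0; apply: ge0_le_integral => //.
- by move=> x _; exact: inner_ge0.
- exact/measurable_funTS/measurable_inner.
- exact/measurable_funTS/measurable_inner.
move=> x _; have mkx := measurable_kernel_section x.
apply: (@le_trans _ _ (\int[mu]_(y in C `|` (B `\` C)) (k x y)%:E)).
  apply: ge0_subset_integral => //.
  - by apply: measurableU => //; exact: measurableD.
  - exact: measurable_funTS.
  - by move=> y _; rewrite lee_fin.
  - by move=> y By; case: (pselect (C y)); [left|right].
rewrite ge0_integral_setU//.
- by rewrite (null_set_integral _ _ BC0) ?adde0//;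
    [exact: measurableD|exact: measurable_funTS].
- exact: measurableD.
- exact: measurable_funTS.
- by move=> y _; rewrite lee_fin.
- by rewrite disj_set2E setDE setICA setICr setI0.
Qed.

Lemma iint_subset A B C : measurable A -> measurable B -> measurable C ->
  B `<=` C -> iint A B <= iint A C.
Proof.
move=> mA mB mC; rewrite -setD_eq0 => BC.
by apply: iint_le_ae => //; rewrite BC measure0.
Qed.

End iterated_integral.

Lemma le_iint d (T : measurableType d) (R : realType)
    (mu : {sigma_finite_measure set T -> \bar R}) (k1 k2 : T -> T -> R) (A B : set T) :
  measurable_fun setT (fun z : T * T => k1 z.1 z.2) ->
  measurable_fun setT (fun z : T * T => k2 z.1 z.2) ->
  (forall x y, 0 <= k1 x y) -> (forall x y, k1 x y <= k2 x y) ->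
  measurable A -> measurable B -> (iint mu k1 A B <= iint mu k2 A B)%E.
Proof.
move=> mk1 mk2 k1_ge0 k12 mA mB.
have k2_ge0 x y : 0 <= k2 x y by exact: le_trans (k1_ge0 x y) (k12 x y).
apply: ge0_le_integral => //.
- by move=> x _; exact: inner_ge0.
- exact/measurable_funTS/measurable_inner.
- exact/measurable_funTS/measurable_inner.
- move=> x _; apply: ge0_le_integral => //.
  + by move=> y _; rewrite lee_fin.
  + exact/measurable_funTS/measurable_kernel_section.
  + exact/measurable_funTS/measurable_kernel_section.
  + by move=> y _; rewrite lee_fin.
Qed.


Lemma iint_cst d (T : measurableType d) (R : realType)
    (mu : {sigma_finite_measure set T -> \bar R}) (r : R) (A B : set T) :
  measurable A -> measurable B ->
  (iint mu (fun _ _ => r) A B = r%:E * mu B * mu A)%E.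
Proof.
move=> mA mB; rewrite -(integral_cst mu mA).
by apply: eq_integral => x _; exact: (integral_cst mu mB r%:E).
Qed.

Lemma le_integralD d (T : measurableType d) (R : realType)
    (mu : {measure set T -> \bar R}) (A : set T) (f g h : T -> \bar R) (c : R) :
  measurable A -> measurable_fun setT f -> measurable_fun setT g ->
  measurable_fun setT h -> (forall x, 0 <= f x)%E -> (forall x, 0 <= g x)%E ->
  (forall x, 0 <= h x)%E -> 0 <= c ->
  (forall x, A x -> f x + g x <= h x + c%:E)%E ->
  (\int[mu]_(x in A) f x + \int[mu]_(x in A) g x <=
   \int[mu]_(x in A) h x + c%:E * mu A)%E.
Proof.
move=> mA mf mg mh f0 g0 h0 c0 fgh.
have mfA := measurable_funTS (D := A) mf; have mgA := measurable_funTS (D := A) mg.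
have mhA := measurable_funTS (D := A) mh.
have c0' x : A x -> (0 <= cst c%:E x)%E by rewrite lee_fin.
rewrite -(integral_cst mu mA).
rewrite -(ge0_integralD mu mA (fun x _ => f0 x) mfA (fun x _ => g0 x) mgA).
rewrite -(ge0_integralD mu mA (fun x _ => h0 x) mhA c0' (measurable_cst _)).
apply: ge0_le_integral => //.
- by move=> x _; exact: adde_ge0.
- exact: emeasurable_funD.
- by apply: emeasurable_funD => //; exact: measurable_cst.
Qed.

(** The principle of calibration. The flow p is dominated by k, and at every point x of
    A what enters from B, together with t(x,.) on K, exceeds what leaves to B by at most
    theta. When this is integrated over A, the exchanges inside A cancel; the bound M
    makes them finite, so that they can be subtracted. *)
Lemma iint_calibration d (T : measurableType d) (R : realType)
    (mu : {sigma_finite_measure set T -> \bar R}) (k p t : T -> T -> R)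
    (A B K : set T) (M theta : R) :
  measurable_fun setT (fun z : T * T => k z.1 z.2) ->
  measurable_fun setT (fun z : T * T => p z.1 z.2) ->
  measurable_fun setT (fun z : T * T => p z.2 z.1) ->
  measurable_fun setT (fun z : T * T => t z.1 z.2) ->
  (forall x y, 0 <= p x y) -> (forall x y, p x y <= k x y) ->
  (forall x y, p x y <= M) -> (forall x y, 0 <= t x y) -> 0 <= theta ->
  measurable A -> measurable B -> measurable K -> A `<=` B ->
  mu A \is a fin_num ->
  (forall x, A x -> (\int[mu]_(y in B) (p y x)%:E + \int[mu]_(y in K) (t x y)%:E
    <= \int[mu]_(y in B) (p x y)%:E + theta%:E)%E) ->
  (iint mu t A K <= iint mu k A (B `\` A) + theta%:E * mu A)%E.
Proof.
move=> mk mp mpT mt p0 pk pM t0 theta0 mA mB mK AB Afin bal.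
have pT0 x y : 0 <= p y x by [].
have mBA : measurable (B `\` A) by exact: measurableD.
have symm : iint mu (fun x y => p y x) A A = iint mu p A A.
  by rewrite (iint_swap mu mpT pT0 mA mA).
have fin : iint mu p A A \is a fin_num.
  rewrite ge0_fin_numE; last exact: (iint_ge0 mu p0).
  apply: (@le_lt_trans _ _ (iint mu (fun _ _ => M) A A)).
    by apply: le_iint.
  by rewrite iint_cst// ltey_eq !fin_numM.
have integrated : (iint mu (fun x y => p y x) A B + iint mu t A K <=
    iint mu p A B + theta%:E * mu A)%E.
  exact: (le_integralD mu mA (measurable_inner mu mpT pT0 mB)
    (measurable_inner mu mt t0 mK) (measurable_inner mu mp p0 mB)
    (inner_ge0 mu pT0 B) (inner_ge0 mu t0 K) (inner_ge0 mu p0 B) theta0 bal).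
have splitB : iint mu p A B = (iint mu p A A + iint mu p A (B `\` A))%E.
  rewrite -{1}(setDUK AB) (iint_setUr mu mp p0 mA mA mBA)//.
  by rewrite disj_set2E setDIK.
rewrite -(leeD2lE _ _ fin); apply: le_trans (le_trans integrated _).
  by apply: leeD2r; rewrite -symm; exact: (iint_subset mu mpT pT0 mA mA mB AB).
rewrite splitB -addeA; apply: leeD2l; apply: leeD2r.
exact: (le_iint mu mp mk p0 pk mA mBA).
Qed.

(** * The calibration inequality in the unit ball *)

Section calibration_inequality.
Context {R : realType} {n : nat}.
Variables q sigma : R.
Hypothesis q_ge0 : 0 <= q.
Hypothesis sigma_gt0 : 0 < sigma.
Hypothesis q_sigma : q + sigma = n.+1%:R.
Variables (K : set (euclidean R n)) (m : R).
Local Notation norm x := (euclidean_dist x origin).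
Local Notation mu := (lebesgue n).
Local Notation kern := (@riesz R n q).
Local Notation B := (@euclidean_ball R n 1).
Hypothesis mK : measurable K.
Hypothesis K_out : K `<=` ~` B.
Hypothesis K_small : (mu K <= m%:E)%E.
Variables rho : R.
Hypothesis rho_gt0 : 0 < rho.
Hypothesis rho_le : rho <= 4^-1.
Implicit Types (x y : euclidean R n) (A : set (euclidean R n)).

Let mB : measurable B. Proof. exact: measurable_euclidean_ball. Qed.

Definition truncated_riesz (eps : R) x y : R :=
  if eps <= euclidean_dist x y then kern x y else 0.

Lemma truncated_riesz_ge0 eps x y : 0 <= truncated_riesz eps x y.
Proof. by rewrite /truncated_riesz; case: ifP => // _; exact: riesz_ge0. Qed.

Lemma measurable_riesz2 :
  measurable_fun setT (fun z : euclidean R n * euclidean R n => kern z.1 z.2).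
Proof. by apply: measurable_riesz; [exact: measurable_fst|exact: measurable_snd]. Qed.

Lemma measurable_truncated_riesz eps :
  measurable_fun setT (fun z : euclidean R n * euclidean R n => truncated_riesz eps z.1 z.2).
Proof.
apply: measurable_fun_ifT => //; last exact: measurable_riesz2.
apply: measurable_fun_ler => //.
by apply: measurable_dist; [exact: measurable_fst|exact: measurable_snd].
Qed.

(** If x and y are at distance less than rho <= 1/4 on different sides of the unit
    sphere, then both are outside the ball of radius 3/4, where the cut-off is 1. *)
Lemma truncated_riesz_le_flow eps x y : B x -> ~ B y ->
  truncated_riesz eps x y <= radial_flow q eps rho y x + (rho `^ q)^-1.
Proof.
rewrite /euclidean_ball/= -/origin => x1 /negP; rewrite -leNgt => y1.
have f0 := radial_flow_ge0 q eps rho y x.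
have r0 : 0 <= (rho `^ q)^-1 by rewrite invr_ge0 powR_ge0.
rewrite /truncated_riesz; case: ifPn => [ed|_]; last by rewrite addr_ge0.
have [dr|rd] := ltP (euclidean_dist x y) rho; last first.
  by have := riesz_le q_ge0 rho_gt0 rd; lra.
have x34 : 3 / 4 <= norm x.
  have := dist_triangle x y origin; rewrite [euclidean_dist y x]dist_sym.
  have := rho_le; lra.
have y34 : 3 / 4 <= norm y by lra.
move: f0; rewrite /radial_flow [euclidean_dist y x]dist_sym ed dr (lt_le_trans x1 y1)/=.
rewrite (cutoff1 x34) (cutoff1 y34) !mul1r.
by rewrite riesz_sym; lra.
Qed.

Definition calibration_cst : R := @curvature_cst R n q sigma * rho `^ sigma + (rho `^ q)^-1 * m.

Lemma calibration_cst_ge0 : 0 <= calibration_cst.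
Proof.
have m0 : 0 <= m by rewrite -lee_fin; exact: le_trans K_small.
apply: addr_ge0; apply: mulr_ge0 => //; rewrite ?invr_ge0 ?powR_ge0//.
by rewrite /curvature_cst mulr_ge0// dyadic_cst_ge0.
Qed.

Section fixed_eps.
Variable eps : R.
Hypothesis eps_gt0 : 0 < eps.
Local Notation flow := (radial_flow q eps rho).

Let mflow : measurable_fun setT
  (fun z : euclidean R n * euclidean R n => flow z.1 z.2).
Proof. by apply: measurable_radial_flow; [exact: measurable_fst|exact: measurable_snd]. Qed.

Let mflowT : measurable_fun setT
  (fun z : euclidean R n * euclidean R n => flow z.2 z.1).
Proof. by apply: measurable_radial_flow; [exact: measurable_snd|exact: measurable_fst]. Qed.

Lemma flow_le_riesz x y : flow x y <= kern x y.
Proof.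
rewrite /radial_flow; case: ifP => _; last exact: riesz_ge0.
have /andP[x0 x1] := cutoff_itv x; have /andP[y0 y1] := cutoff_itv y.
by rewrite ler_piMl ?riesz_ge0// mulr_ile1.
Qed.

Lemma flow_le x y : flow x y <= (eps `^ q)^-1.
Proof.
have := flow_le_riesz x y; rewrite /radial_flow; case: ifP => [|_ _]; last first.
  by rewrite invr_ge0 powR_ge0.
move=> /andP[_ /andP[ed _]] h; apply: le_trans h _; exact: riesz_le.
Qed.

Lemma flow_inward x y : norm x <= norm y -> flow x y = 0.
Proof. by move=> xy; rewrite /radial_flow ltNge xy. Qed.

(** The balance of the flow at x, where the mass coming from outside B is kept only
    to control K; nothing leaves B since the flow goes inwards. *)
Lemma calibration_pointwise x : B x ->
  (\int[mu]_(y in B) (flow y x)%:E + \int[mu]_(y in K) (truncated_riesz eps x y)%:E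
   <= \int[mu]_(y in B) (flow x y)%:E + calibration_cst%:E)%E.
Proof.
move=> Bx.
have mfT : measurable_fun setT (fun y => (flow y x)%:E).
  exact: (measurable_kernel_section (k := fun x y => flow y x) mflowT x).
have mf : measurable_fun setT (fun y => (flow x y)%:E).
  exact: (measurable_kernel_section (k := flow) mflow x).
have mt : measurable_fun setT (fun y => (truncated_riesz eps x y)%:E).
  exact: (measurable_kernel_section (measurable_truncated_riesz eps) x).
have f0 y : (0 <= (flow y x)%:E)%E by rewrite lee_fin radial_flow_ge0.
have splitT : (\int[mu]_y (flow y x)%:E =
    \int[mu]_(y in B) (flow y x)%:E + \int[mu]_(y in ~` B) (flow y x)%:E)%E.
  rewrite -[in LHS](setUv B) ge0_integral_setU//.
  - exact: measurableC.
  - exact: (measurable_funTS mfT).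
  - by rewrite disj_set2E setICr.
have inward : (\int[mu]_y (flow x y)%:E = \int[mu]_(y in B) (flow x y)%:E)%E.
  rewrite [RHS]integral_mkcond; apply: eq_integral => y _; rewrite /patch.
  case: ifPn => //; rewrite notin_setE /euclidean_ball/= -/origin => /negP.
  rewrite -leNgt => y1; rewrite flow_inward// (le_trans _ y1)//.
  by move: Bx; rewrite /euclidean_ball/= -/origin => /ltW.
have outward : (\int[mu]_(y in K) (truncated_riesz eps x y)%:E <=
    \int[mu]_(y in ~` B) (flow y x)%:E + ((rho `^ q)^-1 * m)%:E)%E.
  have r0 : 0 <= (rho `^ q)^-1 by rewrite invr_ge0 powR_ge0.
  apply: (@le_trans _ _ (\int[mu]_(y in K) ((flow y x)%:E + ((rho `^ q)^-1)%:E))%E).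
    apply: ge0_le_integral => //.
    - by move=> y _; rewrite lee_fin truncated_riesz_ge0.
    - exact: (measurable_funTS mt).
    - by apply: measurable_funTS; exact: (emeasurable_funD mfT).
    - by move=> y Ky; rewrite -EFinD lee_fin truncated_riesz_le_flow//; exact: K_out.
  rewrite ge0_integralD//; last exact: (measurable_funTS mfT).
  apply: leeD.
    apply: ge0_subset_integral => //; first exact: measurableC.
    exact: (measurable_funTS mfT).
  by rewrite integral_cst// EFinM lee_wpmul2l// lee_fin.
have rho1 : rho <= 1 by have := rho_le; lra.
have balance := radial_flow_balance q_ge0 sigma_gt0 q_sigma x eps_gt0 rho_gt0 rho1.
have chain (a b c e : \bar R) (k1 k2 : R) : (c <= b + k1%:E -> a + b <= e + k2%:E ->
    a + c <= e + (k2 + k1)%:E)%E.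
  move=> h1 h2; apply: (le_trans (leeD (lexx a) h1)); rewrite addeA.
  by apply: (le_trans (leeD h2 (lexx _))); rewrite -addeA -EFinD.
rewrite splitT inward in balance.
exact: (chain _ _ _ _ _ _ outward balance).
Qed.

Lemma calibration_truncated A : measurable A -> A `<=` B ->
  (iint mu (truncated_riesz eps) A K <=
   iint mu kern A (B `\` A) + calibration_cst%:E * mu A)%E.
Proof.
move=> mA AB; apply: (iint_calibration measurable_riesz2 mflow mflowT
  (measurable_truncated_riesz eps) (radial_flow_ge0 q eps rho) flow_le_riesz flow_le
  (truncated_riesz_ge0 eps) calibration_cst_ge0 mA mB mK AB).
  exact: lebesgue_fin_num_in_ball mA AB.
by move=> x /AB; exact: calibration_pointwise.
Qed.

End fixed_eps.

(** The limit of the truncated inequalities, by monotone convergence. Since A and K are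
    separated by the unit sphere, the truncated domains exhaust A x K. *)
Lemma calibration A : measurable A -> A `<=` B ->
  (iint mu kern A K <= iint mu kern A (B `\` A) + calibration_cst%:E * mu A)%E.
Proof.
move=> mA AB.
pose F (j : nat) := (A `*` K) `&`
  [set z : euclidean R n * euclidean R n | j.+1%:R^-1 <= euclidean_dist z.1 z.2].
have md : measurable_fun setT
    (fun z : euclidean R n * euclidean R n => euclidean_dist z.1 z.2).
  by apply: measurable_dist; [exact: measurable_fst|exact: measurable_snd].
have mF j : measurable (F j).
  apply: measurableI; first exact: measurableX.
  by apply: measurable_fun_setb; exact: measurable_fun_ler.
have FAK : \bigcup_j F j = A `*` K.
  apply/seteqP; split => [z [j _ []]//|z [Az Kz]].
  have d0 : 0 < euclidean_dist z.1 z.2.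
    have := dist_triangle z.1 z.2 origin; rewrite [euclidean_dist z.2 z.1]dist_sym.
    have := AB _ Az; have /negP := K_out Kz.
    by rewrite /euclidean_ball/= -/origin -leNgt; lra.
  exists (Num.truncn (euclidean_dist z.1 z.2)^-1) => //; split => //=.
  have di0 : 0 < (euclidean_dist z.1 z.2)^-1 by rewrite invr_gt0.
  rewrite invf_ple ?posrE//.
  by have /andP[_ /ltW] := truncn_itv (ltW di0).
have mr := measurable_riesz2.
have r0 x y : 0 <= kern x y by exact: riesz_ge0.
have cvgF : (\int[mu \x mu]_(z in F j) (kern z.1 z.2)%:E @[j --> \oo] -->
    iint mu kern A K)%E.
  rewrite -iintE// -FAK; apply: ge0_nondecreasing_set_cvg_integral => //.
  - apply/nondecreasing_seqP => j; rewrite subsetEset => z [AKz /= jz]; split => //=.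
    by apply: le_trans jz; rewrite lef_pV2 ?posrE// ler_nat.
  - by move=> j; apply: measurable_funTS; exact/measurable_EFinP.
  - by move=> j z _; rewrite lee_fin.
rewrite -(cvg_lim _ cvgF)//; apply: lime_le; first by apply/cvg_ex; eexists; exact: cvgF.
apply: nearW => j.
have j0 : 0 < j.+1%:R^-1 :> R by rewrite invr_gt0.
apply: le_trans (calibration_truncated j0 mA AB).
rewrite -iintE//; last 2 first.
- exact: measurable_truncated_riesz.
- by move=> x y; exact: truncated_riesz_ge0.
rewrite /F integral_mkcondr le_eqVlt; apply/orP; left; apply/eqP.
apply: eq_integral => z _; rewrite /patch /truncated_riesz.
case: ifPn => [|]; rewrite ?inE ?notin_setE/=; first by move=> ->.
by move=> /negP/negbTE ->.
Qed.

End calibration_inequality.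

(** * The interaction with far points *)

Section far_interaction.
Context {R : realType} {n : nat}.
Local Notation norm x := (euclidean_dist x origin).
Local Notation mu := (lebesgue n.+1).
Local Notation B := (@euclidean_ball R n.+1 1).
Variable q : R.
Hypothesis q_ge0 : 0 <= q.
Local Notation kern := (@riesz R n.+1 q).

(** The value of the kernel at distance 9 N + 1, which bounds the distance between a point
    of the unit ball and a point of the cube [2, 3]^N. *)
Definition far_cst : R := ((9 * n.+1%:R + 1) `^ q)^-1.

Lemma far_cst_gt0 : 0 < far_cst.
Proof. by rewrite invr_gt0 powR_gt0// ltr_wpDl. Qed.

Lemma far_interaction (A F : set (euclidean R n.+1)) : measurable A -> A `<=` B ->
  measurable F -> (forall y, 2 <= norm y -> F y) ->
  (far_cst%:E * mu A <= iint mu kern A F)%E.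
Proof.
move=> mA AB mF F_far.
pose Q : set (euclidean R n.+1) := box [tuple 5 / 2 | i < n.+1] (1 / 2).
have mQ : measurable Q by exact: measurable_box.
have Q_coord y i : Q y -> 2 <= (tnth y i : R) <= 3.
  by move=> /(_ i); rewrite tnth_mktuple ler_norml => /andP[h1 h2]; apply/andP; split; lra.
have Q_norm_ge y : Q y -> 2 <= norm y.
  move=> /(Q_coord _ ord0) /andP[y2 _].
  have := abs_coord_le_dist y origin ord0; rewrite tnth_mktuple subr0.
  by have := ler_norm (tnth y ord0 : R); lra.
have Q_norm_le y : Q y -> norm y <= 9 * n.+1%:R.
  move=> Qy; have n1 : 1 <= n.+1%:R :> R by rewrite ler1n.
  have : norm y ^+ 2 <= (9 * n.+1%:R) ^+ 2.
    rewrite norm_sqr; apply: (@le_trans _ _ (\sum_(i < n.+1) (9 : R))).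
      by apply: ler_sum => i _; have /andP[h1 h2] := Q_coord _ i Qy; nra.
    by rewrite sumr_const card_ord -mulr_natr; nra.
  by rewrite ler_pXn2r// nnegrE ?dist_ge0// mulr_ge0.
have QF : Q `<=` F by move=> y /Q_norm_ge; exact: F_far.
have muQ : mu Q = 1%E.
  by rewrite /Q lebesgue_box; [rewrite (_ : 2 * (1 / 2) = 1) ?expr1n//; field|lra].
have mr := measurable_riesz2 (n := n.+1) q.
have r0 x y : 0 <= kern x y by exact: riesz_ge0.
apply: (@le_trans _ _ (iint mu kern A Q)); last first.
  exact: (iint_subset mu mr r0 mA mQ mF QF).
rewrite -(integral_cst mu mA); apply: ge0_le_integral.
- exact: mA.
- by move=> x _; rewrite lee_fin ltW// far_cst_gt0.
- exact: measurable_cst.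
- exact: (measurable_funTS (measurable_inner mu mr r0 mQ)).
move=> x /AB; rewrite /euclidean_ball/= -/origin => x1.
rewrite -[leLHS]mule1 -muQ -(integral_cst mu mQ); apply: ge0_le_integral.
- exact: mQ.
- by move=> y _; rewrite lee_fin ltW// far_cst_gt0.
- exact: measurable_cst.
- exact: (measurable_funTS (measurable_kernel_section mr x)).
move=> y Qy; rewrite lee_fin.
have y2 := Q_norm_ge _ Qy; have y9 := Q_norm_le _ Qy.
have d0 : 0 < euclidean_dist x y.
  by have := dist_triangle x y origin; rewrite [euclidean_dist y x]dist_sym; lra.
have dM : euclidean_dist x y <= 9 * n.+1%:R + 1.
  by have := dist_triangle origin x y; rewrite [euclidean_dist origin y]dist_sym; lra.
have M0 : 0 < 9 * n.+1%:R + 1 :> R := lt_le_trans d0 dM.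
rewrite /riesz /far_cst lef_pV2 ?posrE ?powR_gt0//.
by apply: ge0_ler_powR => //; rewrite nnegrE ltW.
Qed.

End far_interaction.

(** * Minimality of the half shell *)

Section minimality.
Context {R : realType} {n : nat}.
Variable s : R.
Hypothesis s_gt0 : 0 < s.
Hypothesis s_lt : s < 1 / 2.
Local Notation norm x := (euclidean_dist x origin).
Local Notation mu := (lebesgue n.+1).
Local Notation B := (@euclidean_ball R n.+1 1).
Let q : R := n.+1%:R + 2 * s.
Let sigma : R := 1 - 2 * s.
Local Notation kern := (@riesz R n.+1 q).

Let q_ge0 : 0 <= q.
Proof. by rewrite addr_ge0// mulr_ge0// ltW. Qed.

Let sigma_gt0 : 0 < sigma. Proof. by have := s_lt; rewrite /sigma; lra. Qed.

Let q_sigma : q + sigma = n.+2%:R.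
Proof. by rewrite /q /sigma -[n.+2]addn1 natrD; ring. Qed.

Let mriesz := measurable_riesz2 (n := n.+1) q.

Let riesz0 (x y : euclidean R n.+1) : 0 <= kern x y.
Proof. exact: riesz_ge0. Qed.

Let mB : measurable B. Proof. exact: measurable_euclidean_ball. Qed.

Lemma interactionE (F G : set (euclidean R n.+1)) : measurable F -> measurable G ->
  interaction s F G = iint mu kern F G.
Proof. by move=> mF mG; rewrite -(iintE mu mriesz riesz0 mF mG). Qed.

(** Since sigma = 1 - 2 s > 0, the curvature term is small at small scales. *)
Lemma exists_flow_radius : exists2 rho : R, 0 < rho <= 4^-1 &
  @curvature_cst R n.+1 q sigma * rho `^ sigma <= far_cst (n := n) q / 4.
Proof.
set C := curvature_cst _ _; set c0 := far_cst _.
have c00 : 0 < c0 := far_cst_gt0 q.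
have C0 : 0 <= C.
  by rewrite /C /curvature_cst mulr_ge0// dyadic_cst_ge0.
pose t := c0 / 4 / (C + 1).
have t0 : 0 < t by rewrite !divr_gt0//; lra.
exists (Num.min 4^-1 (t `^ sigma^-1)).
  by rewrite lt_min ge_min lexx invr_gt0 powR_gt0// andbT ltr0n.
have rt : Num.min 4^-1 (t `^ sigma^-1) `^ sigma <= t.
  rewrite -[leRHS]powRr1 ?(ltW t0)// -[X in _ <= _ `^ X](@mulVf _ sigma) ?gt_eqF// powRrM.
  apply: ge0_ler_powR; rewrite ?(ltW sigma_gt0)// ?nnegrE ?powR_ge0 ?ge_min ?lexx ?orbT//.
  by rewrite le_min powR_ge0 invr_ge0 andbT.
apply: le_trans (ler_wpM2l C0 rt) _.
rewrite /t mulrA ler_pdivrMr; last lra.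
by rewrite mulrC ler_wpM2l//; lra.
Qed.

(** The radius rho is fixed first, depending on the dimension and on s only; then the shell
    is taken so thin that its interaction at distances larger than rho is negligible. *)
Lemma calibration_gap : exists eta delta0 : R, [/\ 0 < eta, 0 < delta0 &
  forall delta, 0 < delta -> delta <= delta0 ->
  let K : set (euclidean R n.+1) := half_shell delta in
  iint mu kern B K \is a fin_num /\
  forall A, measurable A -> A `<=` B ->
   (iint mu kern A K + eta%:E * mu A <=
    iint mu kern A (B `\` A) + iint mu kern A (~` (B `|` K)))%E].
Proof.
have [rho /andP[rho0 rho4] rhoC] := exists_flow_radius.
pose c0 := far_cst (n := n) q.
have c00 : 0 < c0 := far_cst_gt0 q.
have rq0 : 0 < rho `^ q by rewrite powR_gt0.
have m0 : 0 < rho `^ q * (c0 / 4) by rewrite mulr_gt0// divr_gt0.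
have [delta0 [d0 d1 K_small]] := @lebesgue_half_shell_small R n _ m0.
exists (c0 / 2), delta0; split => //; first by rewrite divr_gt0.
move=> delta dpos dle K.
have mK : measurable K by exact: measurable_half_shell.
have K_out : K `<=` ~` B by move=> x [[_]].
have calib A := calibration q_ge0 sigma_gt0 q_sigma mK K_out (K_small _ dpos dle)
  rho0 rho4 (A := A).
set th := calibration_cst _ _ _ _ in calib.
have th_le : th <= c0 / 2.
  rewrite /th /calibration_cst mulKf ?gt_eqF//.
  by move: rhoC; rewrite -/c0; lra.
split.
  rewrite ge0_fin_numE; last exact: (iint_ge0 mu riesz0).
  apply: le_lt_trans (calib B mB (@subset_refl _ _)) _.
  rewrite setDv (_ : iint mu kern B set0 = 0%E); last first.
    rewrite /iint (eq_integral (cst 0%E)) ?integral0// => x _.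
    by rewrite integral_set0.
  rewrite add0e ltey_eq fin_numM//.
  exact: lebesgue_fin_num_in_ball mB (@subset_refl _ _).
move=> A mA AB; have Afin := lebesgue_fin_num_in_ball mA AB.
have mF : measurable (~` (B `|` K)) by apply: measurableC; exact: measurableU.
have F_far y : 2 <= norm y -> (~` (B `|` K)) y.
  move=> y2 [|[[]]]; rewrite /euclidean_ball/= -/origin; lra.
have far := far_interaction q_ge0 mA AB mF F_far.
apply: (le_trans (leeD (calib A mA AB) (lexx _))).
rewrite -addeA; apply: leeD2l; apply: le_trans far.
rewrite -/c0 -(fineK Afin) -!EFinM -EFinD lee_fin -mulrDl.
by rewrite ler_wpM2r ?fine_ge0//; lra.
Qed.

Section fixed_shell.
Variables (delta eta : R).
Hypothesis eta_gt0 : 0 < eta.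
Let K : set (euclidean R n.+1) := half_shell delta.
Hypothesis K_fin : iint mu kern B K \is a fin_num.
Hypothesis gap : forall A, measurable A -> A `<=` B ->
   (iint mu kern A K + eta%:E * mu A <=
    iint mu kern A (B `\` A) + iint mu kern A (~` (B `|` K)))%E.

Let mK : measurable K. Proof. exact: measurable_half_shell. Qed.

Let K_out : K `<=` ~` B. Proof. by move=> x [[_]]. Qed.

Let KB : K `\` B = K.
Proof. by apply/setDidl/seteqP; split => // x [/K_out]. Qed.

Lemma Per_half_shell : Per s K B = iint mu kern B K.
Proof.
have KIB : K `&` B = set0 by apply/seteqP; split => // x [/K_out].
have BK : B `\` K = B.
  by apply/seteqP; split=> [x []//|x Bx]; split => // /K_out.
rewrite /Per KIB BK KB !interactionE//; last exact: measurableC.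
by rewrite {1}/iint integral_set0 add0e.
Qed.

(** With A the part of E in the ball, Per(E) is at least
    L(A, B \ A) + L(A, (B u K)^c) + L(B \ A, K), while
    Per(K) = L(A, K) + L(B \ A, K). The exterior part of E is K up to a null set only. *)
Lemma Per_half_shell_gap E : admissible B K E ->
  (Per s K B + eta%:E * mu (E `&` B) <= Per s E B)%E.
Proof.
move=> [mE EK]; set A := E `&` B.
have mA : measurable A by exact: measurableI.
have AB : A `<=` B by move=> x [].
have mBA : measurable (B `\` A) by exact: measurableD.
have mEB : measurable (E `\` B) by exact: measurableD.
have mBK : measurable (~` (B `|` K)) by apply: measurableC; exact: measurableU.
have mEC : measurable (~` E) by exact: measurableC.
have mZ : measurable ((E `\` B) `+` K) by apply: measurableU; exact: measurableD.
have BE : B `\` E = B `\` A.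
  apply/seteqP; split=> x [Bx Ex]; split=> //; first by case.
  by move=> Ex'; exact: Ex.
rewrite Per_half_shell /Per -/A BE !interactionE//.
have -> : iint mu kern B K = (iint mu kern A K + iint mu kern (B `\` A) K)%E.
  rewrite -[in LHS](setDUK AB); apply: (iint_setUl mu mriesz riesz0 mA mBA mK).
  by rewrite disj_set2E setDIK.
rewrite addeAC; apply: leeD.
  apply: (le_trans (gap mA AB)).
  rewrite -(iint_setUr mu mriesz riesz0 mA mBA mBK); last first.
    by rewrite disj_set2E; apply/eqP/seteqP; split=> // x [[Bx _] []]; left.
  have mU : measurable (B `\` A `|` ~` (B `|` K)) by exact: measurableU.
  apply: (iint_le_ae mriesz riesz0 mA mU mEC).
  apply: (subset_measure0 _ mZ _ EK); first exact: measurableD.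
  move=> x [[[Bx nA]|nBK] nnE].
    by exfalso; apply: nnE => Ex; apply: nA.
  left; split; last by move=> Kx; apply: nBK; right.
  by split; [exact: contrapT|move=> Bx; apply: nBK; left].
apply: (iint_le_ae mriesz riesz0 mBA mK mEB).
apply: (subset_measure0 _ mZ _ EK); first exact: measurableD.
by move=> x; right.
Qed.

Lemma half_shell_admissible : admissible B K K.
Proof. by split => //; rewrite /eq_ae KB setYK measure0. Qed.

Lemma half_shell_minimizer : minimizer s B K K.
Proof.
split=> [|E EK]; first exact: half_shell_admissible.
apply: le_trans (Per_half_shell_gap EK); rewrite leeDl// mule_ge0//.
by rewrite lee_fin ltW.
Qed.

Lemma half_shell_unique E : minimizer s B K E -> eq_ae E K.
Proof.
move=> [EK Emin]; have gapE := Per_half_shell_gap EK.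
have := le_trans gapE (Emin _ half_shell_admissible).
rewrite -[leRHS]adde0 Per_half_shell (leeD2lE _ _ K_fin).
rewrite -[leRHS](mule0 eta%:E) lee_pmul2l ?lte_fin// => muA.
have [mE EK0] := EK.
have A0 : mu (E `&` B) = 0%E by apply/eqP; rewrite eq_le muA measure_ge0.
have mA : measurable (E `&` B) by exact: measurableI.
have mZ : measurable ((E `\` B) `+` K).
  by apply: measurableU; apply: measurableD => //; exact: measurableD.
rewrite /eq_ae; apply: (@subset_measure0 _ _ _ mu _ (((E `\` B) `+` K) `|` (E `&` B))).
- by apply: measurableU; exact: measurableD.
- exact: measurableU.
- move=> x [[Ex nKx]|[Kx nEx]].
    by case: (pselect (B x)) => Bx; [right|left; left].
  by left; right; split=> // -[Ex _]; exact: nEx.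
- exact: etrans (measureU0 mZ mA A0) EK0.
Qed.

End fixed_shell.
End minimality.

Theorem theorem1p1 (R : realType) (n : nat) (s : R) (s_gt0 : 0 < s)
    (s_lt : s < 1 / 2) :
  exists delta0 : R, 0 < delta0 /\
    forall delta : R, 0 < delta -> delta <= delta0 ->
      let K : set (euclidean R n.+1) := half_shell delta in
      minimizer s (euclidean_ball 1) K K /\
      (forall E : set (euclidean R n.+1),
         minimizer s (euclidean_ball 1) K E -> eq_ae E K).
Proof.
have [eta [delta0 [eta0 d0 gap]]] := @calibration_gap R n s s_gt0 s_lt.
exists delta0; split => // delta dpos dle K.
have [K_fin gapK] := gap delta dpos dle.
split; first exact: (half_shell_minimizer eta0 gapK).
exact: (half_shell_unique eta0 K_fin gapK).
Qed.
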